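(* Let $d$ be a metric on $\langle\mathbb{F}_0\rangle$ such that $d$-balls in $\langle\mathbb{F}_0\rangle$ are convex sets. Suppose that: (1) for every $\epsilon>0$, $\Pi\left(f: K^\star(f_0,f)<\epsilon\right)>0$; (2) for every $\epsilon>0$ there is $\delta>0$ such that $\{f\in\langle\mathbb{F}_0\rangle:\inf_{0\le\alpha\le1}h^\star_\alpha(f_0,f)>e^{-\delta}\}\subseteq\{f\in\langle\mathbb{F}_0\rangle: d(f,f^\star)<\epsilon\}$; (3) there exist subsets $V_n,W_n$, $n\ge1$, with $\mathbb{F}_0\subseteq V_n\cup W_n$ such that (a) $\Pi(W_n)<e^{-n\Delta}$ for some $\Delta>2\,\mathsf{E}_0\log\frac{f_0}{f^\star}$, and (b) for every $\epsilon>0$, $V_n$ can be covered by $J_n$ $d$-balls in $\langle\mathbb{F}_0\rangle$ of radius less than $\epsilon$, where $J_n$ grows at most polynomially in $n$, i.e. $J_n\le a n^r$ for some constants $a,r>0$. Then for every $\epsilon>0$, with $U_\epsilon=\{f\in\langle\mathbb{F}_0\rangle: d(f,f^\star)<\epsilon\}$, $$\Pi(U_\epsilon^c\mid Y_{1:n})\to0\quad\text{as }n\to\infty,\qquad\mathsf{P}_0\text{-almost surely}.$$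
   Context: Let $(\mathbb{Y},\mathscr{Y},\mu)$ be a $\sigma$-finite measure space, $\mathbb{F}_0$ a family of probability densities with respect to $\mu$, and $f_0$ a ''true'' probability density with respect to $\mu$, not necessarily in $\mathbb{F}_0$. $Y_1,Y_2,\dots$ are i.i.d. with density $f_0$, $Y_{1:n}=(Y_1,\dots,Y_n)$; $\mathsf{P}_0,\mathsf{E}_0$ denote probability and expectation under $f_0$ (and under its products). $\Pi$ is a probability measure (prior) on $\mathbb{F}_0$; it is understood that families of densities carry a $\sigma$-algebra making $(y,f)\mapsto f(y)$ jointly measurable, and that $d$-balls and the sets $V_n,W_n$ are measurable. $K(f_0,f)=\mathsf{E}_0\log(f_0/f)=\int\log(f_0/f)\,f_0\,d\mu$. There is a fixed unique $f^\star\in\mathbb{F}_0$ with $K(f_0,f^\star)=\inf_{f\in\mathbb{F}_0}K(f_0,f)$, understood to be finite, and for any density $f$, $K^\star(f_0,f)=K(f_0,f)-K(f_0,f^\star)$. Standing assumptions: $\int(f/f^\star)f_0\,d\mu<\infty$ for all $f\in\mathbb{F}_0$, and $\int(f_0/f^\star)\,d\mu<\infty$. A set $A$ of densities is called convex if it is closed under mixtures: for every probability measure $\nu$ on $A$, the density $\int_A f\,\nu(df)$ belongs to $A$. $\langle\mathbb{F}_0\rangle$ is the smallest convex set (in this sense) containing $\mathbb{F}_0$, and $\Pi$ is extended to $\langle\mathbb{F}_0\rangle$ by $\Pi(A)=\Pi(A\cap\mathbb{F}_0)$. $h^\star_\alpha(f_0,f)=\mathsf{E}_0(f/f^\star)^\alpha=\int(f/f^\star)^\alpha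 f_0\,d\mu$ for $0<\alpha\le1$, and $h^\star_0(f_0,f)=1$. The posterior is $$\Pi(A\mid Y_{1:n})=\frac{\int_A\prod_{i=1}^n \frac{f(Y_i)}{f^\star(Y_i)}\,d\Pi(f)}{\int\prod_{i=1}^n \frac{f(Y_i)}{f^\star(Y_i)}\,d\Pi(f)}.$$ *)

(* Defs.v *)
From HB Require Import structures.
From mathcomp Require Import all_boot all_order all_algebra.
From mathcomp Require Import all_classical all_reals all_analysis.

Set Implicit Arguments.
Unset Strict Implicit.
Unset Printing Implicit Defensive.

Import Order.TTheory GRing.Theory Num.Theory.
Import numFieldNormedType.Exports.

Local Open Scope classical_set_scope.
Local Open Scope ring_scope.
Local Open Scope ereal_scope.

(* A density is represented by a function Y -> R, and two densities that agree
   mu-almost everywhere are identified: metrics separate densities only up to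
   [ae_same], and convex sets are closed under [ae_same] (mix along a Dirac
   mass).  A division by zero in R gives 0. *)

Section Densities.
Context (dY : measure_display) (Y : measurableType dY) (R : realType).
Variable mu : {sigma_finite_measure set Y -> \bar R}.
Implicit Types (f g h : Y -> R) (A F H : set (Y -> R)).

Definition density : set (Y -> R) :=
  [set f : Y -> R | [/\ measurable_fun [set: Y] f, (forall y, (0 <= f y)%R)
             & \int[mu]_y (f y)%:E = 1]].

Definition ae_same f g : Prop := {ae mu, forall y, f y = g y}.

(* A sigma-algebra on F is given as the trace on F of a sigma-algebra on
   Y -> R, generated by S, to which F belongs. *)
Definition jointly_measurable (S : set (set (Y -> R))) F : Prop :=
  S.-sigma.-measurable F /\
  measurable_fun ([set: Y] `*` F : set (Y * g_sigma_algebraType S))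
    (fun yf : Y * g_sigma_algebraType S => yf.2 yf.1).

(* Closure under mixtures.  The mixing measure nu lives on a subset G of A and
   on some sigma-algebra of G making the evaluation jointly measurable; taking
   G = A would be too restrictive, since a set A containing all the versions
   of its members need not carry such a sigma-algebra.  Every version of the
   mixture is required to be in A. *)
Definition convex_densities A : Prop :=
  A `<=` density /\
  forall (S : set (set (Y -> R))) (nu : probability (g_sigma_algebraType S) R)
         G h,
    G `<=` A -> jointly_measurable S G -> nu G = 1 -> density h ->
    {ae mu, forall y, (h y)%:E = \int[nu]_(f in G) (f y)%:E} ->
    A h.

Definition convex_hull F : set (Y -> R) := smallest convex_densities F.

Definition metric_on H (d : (Y -> R) -> (Y -> R) -> R) : Prop :=
  [/\ forall f g, H f -> H g -> (0 <= d f g)%R,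
      forall f g, H f -> H g -> (d f g = 0%R <-> ae_same f g),
      forall f g, H f -> H g -> d f g = d g f
    & forall f g h, H f -> H g -> H h -> (d f h <= d f g + d g h)%R].

Definition dball H (d : (Y -> R) -> (Y -> R) -> R) (c : Y -> R) (r : R) :
  set (Y -> R) := [set f : Y -> R | H f /\ (d f c < r)%R].

(* The quotient and the logarithm are taken in \bar R: the integrand is +oo
   where f = 0 < f0, and 0 where f0 = 0. *)
Definition KL f0 f : \bar R :=
  \int[mu]_y ((f0 y)%:E * lne ((f0 y)%:E / (f y)%:E)).

Definition KLstar f0 fstar f : \bar R := KL f0 f - KL f0 fstar.

(* When KL f0 fstar is finite, fstar > 0 almost everywhere on f0 > 0, so the
   value of f / fstar at the zeros of fstar does not matter. *)
Definition hstar f0 fstar (alpha : R) f : \bar R :=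
  if alpha == 0%R then 1
  else \int[mu]_y (((f y / fstar y) `^ alpha)%R * f0 y)%:E.

Definition KL_minimizer F f0 fstar : Prop :=
  [/\ F fstar, KL f0 fstar \is a fin_num,
      KL f0 fstar = ereal_inf [set KL f0 f | f in F]
    & forall f, F f -> KL f0 f = KL f0 fstar -> ae_same f fstar].

(* The sample Y_1, ..., Y_n is y 0, ..., y n.-1. *)
Definition lik_ratio fstar (n : nat) (y : nat -> Y) f : R :=
  (\prod_(i < n) (f (y i) / fstar (y i)))%R.

Definition posterior (S : set (set (Y -> R)))
    (Pi : probability (g_sigma_algebraType S) R) F fstar
    (n : nat) (y : nat -> Y) A : \bar R :=
  (\int[Pi]_(f in A `&` F) (lik_ratio fstar n y f)%:E) /
  (\int[Pi]_(f in F) (lik_ratio fstar n y f)%:E).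

Definition iid_density (dO : measure_display) (Omega : measurableType dO)
    (P : probability Omega R) (X : nat -> {RV P >-> Y}) f0 : Prop :=
  (forall i (B : set Y), measurable B ->
     P (X i @^-1` B) = \int[mu]_(y in B) (f0 y)%:E) /\
  (forall (I : seq nat) (B : nat -> set Y), uniq I ->
     (forall i, measurable (B i)) ->
     P (\bigcap_(i in [set` I]) (X i @^-1` B i)) =
     \prod_(i <- I) P (X i @^-1` B i)).

End Densities.

(* Main.v *)
(* The likelihood ratio integrated over the prior mass of a convex set B is a
   telescoping product of predictive ratios: given the first observations it is
   multiplied by h(Y) / fstar(Y), where the predictive density h is a mixture
   of members of B, hence is in B.  So if the a-th moment of f / fstar is at
   most c < 1 for all f in B and one a in [0, 1], then the a-th moment of the
   integrated ratio over n observations is at most c ^ n, and Markov's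
   inequality makes the ratio exponentially small.  A common exponent a exists
   by a minimax argument: a |-> hstar a f is convex in a and concave in f, so
   that the sublevel sets in a at a fixed level are intervals meeting
   pairwise, to which Helly's theorem on the line applies. Unions of
   polynomially many balls keep the exponential decay, which Borel-Cantelli
   makes almost sure. On W n the likelihood ratio is compared with f0, for
   which the integrated ratio has expectation at most Pi (W n), at the cost of
   a factor exp (n (K + o(1))) from the law of large numbers. The denominator
   is at least exp (- n e) eventually for every e > 0, by the law of large
   numbers applied to each f of a Kullback-Leibler ball and Fubini's theorem. *)

Require Import Defs.
From HB Require Import structures.
From mathcomp Require Import all_boot all_order all_algebra.
From mathcomp Require Import all_classical all_reals all_analysis.
From mathcomp Require Import measurable_realfun ring lra.

Set Implicit Arguments.
Unset Strict Implicit.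
Unset Printing Implicit Defensive.

Import Order.TTheory GRing.Theory Num.Theory.
Import numFieldNormedType.Exports.

Local Open Scope classical_set_scope.
Local Open Scope ring_scope.
Local Open Scope ereal_scope.

(** All almost sure statements are proved on the sequence space, under the law [PP] of the whole
    sample. Dropping the first observation preserves [PP], and the telescoping induction therefore
    runs from the front: the first observation is absorbed into a weight on the densities, over
    which the induction hypothesis is quantified. The maximal inequality behind the law of large
    numbers uses the same invariance.

    Two obstacles shape the search for a common exponent. Moments can be infinite for some
    exponents, so the minimax argument works with extended values and pays for it by passing from a
    level [c0] to a larger level [c]. And the exponents that work for individual densities may have
    0 as their only common limit, although [hstar] equals 1 at 0. Moments are therefore taken with
    [0 ^ 0 = 0], which makes the sublevel sets in the exponent closed, and the predictive argument
    remains valid at exponent 0.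

    In the evidence bound the null set of the law of large numbers depends on the density; Fubini's
    theorem exchanges it for a prior-null set of densities at almost every sample. *)

Section measure_with_density.
Context (dT : measure_display) (T : measurableType dT) (R : realType).
Variables (mu nu : {measure set T -> \bar R}) (w : T -> \bar R).
Hypotheses (mw : measurable_fun setT w) (w0 : forall x, 0 <= w x).
Hypothesis nuE : forall A, measurable A -> nu A = \int[mu]_(x in A) w x.

Import HBNNSimple.

(** Monotone convergence reduces this to simple functions, where it is [nuE] summed over finitely
    many values. It serves for [Q] against [mu] and for normalized weights against the prior. *)
Lemma ge0_integral_density (g : T -> \bar R) :
  measurable_fun setT g -> (forall x, 0 <= g x) ->
  \int[nu]_x g x = \int[mu]_x (g x * w x).
Proof.
move=> mg g0; pose g_ := nnsfun_approx measurableT mg.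
have cg x : EFin (g_ n x) @[n --> \oo] --> g x by exact: cvg_nnsfun_approx.
have leg n x : (g_ n x)%:E <= g x.
  rewrite -(cvg_lim _ (cg x))//; apply: lime_ge; first exact: cvgP (cg x).
  by exists n => // m /= nm; rewrite lee_fin; exact/lefP/nd_nnsfun_approx.
transitivity (limn (fun n => \int[nu]_x (g_ n x)%:E)).
  rewrite -monotone_convergence//.
  - by apply: eq_integral => x _; apply/esym/cvg_lim => //; exact: cg.
  - by move=> n; exact/measurable_EFinP/measurable_funP.
  - by move=> n x _; rewrite lee_fin.
  - by move=> x _ m n mn; rewrite lee_fin; exact/lefP/nd_nnsfun_approx.
have mgw n : measurable_fun setT (fun x => (g_ n x)%:E * w x).
  by apply: emeasurable_funM => //; exact/measurable_EFinP/measurable_funP.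
transitivity (limn (fun n => \int[mu]_x ((g_ n x)%:E * w x))); last first.
  rewrite -monotone_convergence//.
  - apply: eq_integral => x _; apply/cvg_lim => //.
    (* The limit of the product could read [0 * +oo], so vanishing factors are treated apart. *)
    have [->|wN0] := eqVneq (w x) 0.
      by rewrite mule0; under eq_fun do rewrite mule0; exact: cvg_cst.
    have [gx0|gx0] := eqVneq (g x) 0.
      rewrite gx0 mul0e (_ : (fun _ => _) = cst 0); first exact: cvg_cst.
      apply/funext => n /=; suff : (g_ n x)%:E <= 0.
        rewrite lee_fin => gn0; have /eqP -> : (g_ n x == 0)%R.
          by rewrite eq_le gn0 fun_ge0.
        by rewrite mul0e.
      by rewrite -gx0.
    apply: cvgeM => //; [|exact: cvg_cst].
    by rewrite mule_defE (negbTE gx0) (negbTE wN0).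
  - by move=> n x _; rewrite mule_ge0// lee_fin.
  - by move=> x _ m n mn; rewrite lee_wpmul2r// lee_fin; exact/lefP/nd_nnsfun_approx.
congr (limn _); apply/funext => n.
have mk (k : R) : measurable (g_ n @^-1` [set k]) by [].
rewrite integral_nnsfun// (_ : _ \_ _ = g_ n); last first.
  by apply/funext => x; rewrite patchE in_setT.
rewrite sintegralE.
transitivity (\int[mu]_x
    (\sum_(k \in range (g_ n)) (k%:E * (\1_(g_ n @^-1` [set k]) x)%:E * w x))).
  rewrite ge0_integral_fsum//; last 2 first.
  - move=> k; apply: emeasurable_funM => //.
    by apply: measurable_funeM; exact/measurable_EFinP.
  - move=> k x _; rewrite mule_ge0//.
    exact: nnfun_muleindic_ge0.
  apply: eq_fsbigr => k /[!inE] -[y _ <-].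
  rewrite nuE// integral_mkcond -ge0_integralZl_EFin//; last 2 first.
  - by move=> x _; rewrite patchE; case: ifP.
  - exact/(measurable_restrictT _ _).1/measurable_funTS.
  apply: eq_integral => x _; rewrite patchE indicE -muleA; congr (_ * _).
  by case: ifPn; rewrite ?mul1e// mul0e.
apply: eq_integral => x _.
rewrite [X in _ = X%:E * _]fimfunE -fsumEFin// ge0_mule_fsuml//.
by move=> k; exact: nnfun_muleindic_ge0.
Qed.

End measure_with_density.

(** * Laws on the space of samples *)

Section cylinders.
Context (dY : measure_display) (Y : measurableType dY).

Definition cylinder (k : nat) (B : nat -> set Y) : set (nat -> Y) :=
  [set x | forall i, (i < k)%N -> B i (x i)].

Definition cylinders : set (set (nat -> Y)) :=
  [set C | exists k B, (forall i, measurable (B i)) /\ C = cylinder k B].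

End cylinders.

Notation seq_space Y := (g_sigma_algebraType (@cylinders _ Y)).

Section sequence_space.
Context (dY : measure_display) (Y : measurableType dY) (R : realType).

Definition seq_shift (x : seq_space Y) : seq_space Y := fun i => x i.+1.

(** Cylinders form a generating pi-system, so this determines [PP]. The instance in use will be the
    law of the given sample. *)
Definition iid_law (Q : probability Y R) (PP : probability (seq_space Y) R) :=
  forall k B, (forall i, measurable (B i)) ->
    PP (cylinder k B) = \prod_(i < k) Q (B i).

Lemma measurable_cylinder k (B : nat -> set Y) : (forall i, measurable (B i)) ->
  measurable (cylinder k B : set (seq_space Y)).
Proof. by move=> mB; apply: sub_sigma_algebra; exists k, B. Qed.

Lemma measurable_coord i : measurable_fun setT (fun x : seq_space Y => x i).
Proof.
move=> _ B mB; rewrite setTI.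
rewrite (_ : _ @^-1` _ = cylinder i.+1 (fun j => if j == i then B else setT)).
  by apply: measurable_cylinder => j; case: ifP.
apply/seteqP; split=> [x /= Bx j _|x /= /(_ i (ltnSn i))]; last by rewrite eqxx.
by case: eqP => [->|].
Qed.

Lemma setI_closed_cylinders : setI_closed (@cylinders _ Y).
Proof.
move=> _ _ [k [B [mB ->]]] [l [C [mC ->]]].
exists (maxn k l), (fun i => (if (i < k)%N then B i else setT) `&`
                             (if (i < l)%N then C i else setT)); split.
  by move=> i; apply: measurableI; case: ifP.
apply/seteqP; split=> [x [/= Bx Cx] i _|x /= BCx].
  by split; case: ifPn => // ?; [exact: Bx|exact: Cx].
by split=> i ik; have := BCx i; rewrite leq_max ik ?orbT => /(_ isT)[].
Qed.

Lemma measurable_to_seq_space d (T : measurableType d) (f : T -> seq_space Y) :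
  (forall i, measurable_fun setT (fun t => f t i)) -> measurable_fun setT f.
Proof.
move=> mf; refine (@measurability _ _ T (seq_space Y) setT f (@cylinders _ Y) erefl _).
move=> _ [_ [k [B [mB ->]]] <-]; rewrite setTI.
rewrite (_ : _ @^-1` _ = \bigcap_(i < k) ((fun t => f t i) @^-1` B i)); last first.
  by apply/seteqP; split=> [t h i|t h i]; exact: h.
rewrite bigcap_mkord; apply: bigsetI_measurable => i _.
by rewrite -[X in measurable X]setTI; exact: mf.
Qed.

Lemma measurable_seq_shift : measurable_fun setT seq_shift.
Proof.
by apply: measurable_to_seq_space => i; exact: (measurable_coord i.+1).
Qed.

Section iid.
Variables (Q : probability Y R) (PP : probability (seq_space Y) R).
Hypothesis QPP : iid_law Q PP.

Let split0 (x : seq_space Y) : Y * seq_space Y := (x 0%N, seq_shift x).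

Let msplit0 : measurable_fun setT split0.
Proof.
by apply: measurable_fun_pair;
  [exact: measurable_coord|exact: measurable_seq_shift].
Qed.

(** Both sides are finite measures in [B] that agree on cylinders: putting [A] in front of a
    cylinder of length [k] gives one of length [k.+1]. *)
Lemma iid_law_rect A B : measurable A -> measurable B ->
  PP (split0 @^-1` (A `*` B)) = Q A * PP B.
Proof.
move=> mA mB.
have mA0 : measurable [set x : seq_space Y | A (x 0%N)].
  by rewrite -[X in measurable X]setTI; exact: (measurable_coord 0%N).
have QA : (0 <= fine (Q A))%R by rewrite fine_ge0.
pose m1_ := pushforward (mrestr PP mA0) seq_shift :
  {measure set (seq_space Y) -> \bar R}.
pose m1 := m1_ measurable_seq_shift.
pose m2 : {measure set (seq_space Y) -> \bar R} := mscale (NngNum QA) PP.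
suff : m1 B = m2 B.
  rewrite /m1 /m1_ /m2/= /mscale/= /pushforward/= /mrestr fineK ?fin_num_measure//.
  by move=> <-; congr (PP _); apply/seteqP; split=> x [].
apply: (measure_unique _ (fun=> setT)) => //.
- exact: setI_closed_cylinders.
- by move=> _; exists 0%N, (fun=> setT); split=> //; apply/seteqP; split.
- exact: bigcup_const.
- move=> _ [k [C [mC ->]]]; rewrite /m1 /m1_ /m2/= /mscale/= fineK ?fin_num_measure//.
  rewrite QPP// /pushforward/= /mrestr.
  rewrite (_ : _ `&` _ = cylinder k.+1 (fun i => if i is j.+1 then C j else A)).
    by rewrite QPP ?big_ord_recl//; case.
  apply/seteqP; split=> [x [Cx Ax] [|i] ik|x Cx]; [by []|exact: Cx|].
  by split=> [i ik|]; [exact: (Cx i.+1)|exact: (Cx 0%N)].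
- move=> _; rewrite /m1 /m1_ /pushforward/= /mrestr.
  rewrite -ge0_fin_numE ?measure_ge0// fin_num_measure//; apply: measurableI => //.
  by rewrite preimage_setT.
Qed.

(** Uniqueness of the product measure makes the first observation and the shifted sample an
    independent pair with laws [Q] and [PP]. *)
Lemma iid_law_peel (F : Y * seq_space Y -> \bar R) :
  measurable_fun setT F -> (forall z, 0 <= F z) ->
  \int[PP]_x F (x 0%N, seq_shift x) = \int[Q]_y \int[PP]_x F (y, x).
Proof.
move=> mF F0.
rewrite -(fubini_tonelli1 F)//.
transitivity (\int[PP]_(x in split0 @^-1` setT) (F \o split0) x).
  by rewrite preimage_setT.
rewrite -ge0_integral_pushforward//.
pose m_ := pushforward PP split0 : {measure set (Y * seq_space Y) -> \bar R}.
apply/esym; apply: (eq_measure_integral (m_ msplit0)) => A mA _.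
by apply: product_measure_unique => //; exact: iid_law_rect.
Qed.

Lemma iid_law_shift (F : seq_space Y -> \bar R) :
  measurable_fun setT F -> (forall z, 0 <= F z) ->
  \int[PP]_x F (seq_shift x) = \int[PP]_x F x.
Proof.
move=> mF F0; rewrite -[RHS]mule1 -(probability_setT Q) -integral_cst//.
apply: (iid_law_peel (F := F \o snd)) => [|z]; last exact: F0.
exact: (measurableT_comp mF measurable_snd).
Qed.

Lemma iid_law_coord i (g : Y -> \bar R) :
  measurable_fun setT g -> (forall y, 0 <= g y) ->
  \int[PP]_x g (x i) = \int[Q]_y g y.
Proof.
move=> mg g0; elim: i => [|i IH]; last first.
  rewrite -IH -(iid_law_shift (F := fun x => g (x i)))//.
  exact: (measurableT_comp mg (measurable_coord i)).
rewrite [LHS](iid_law_peel (F := g \o fst)); last 2 first.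
- exact: (measurableT_comp mg measurable_fst).
- by move=> z; exact: g0.
apply: eq_integral => y _.
by rewrite -[RHS]mule1 -(probability_setT PP) -integral_cst.
Qed.

Lemma iid_law_ae i (A : Y -> Prop) :
  {ae Q, forall y, A y} -> {ae PP, forall x, A (x i)}.
Proof.
move=> [N [mN N0 AN]].
have mNi : measurable ((fun x : seq_space Y => x i) @^-1` N).
  by rewrite -[X in measurable X]setTI; exact: measurable_coord.
exists ((fun x : seq_space Y => x i) @^-1` N); split=> //; last first.
  by move=> x /= nA; exact: AN.
have : \int[PP]_x (\1_((fun x : seq_space Y => x i) @^-1` N) x)%:E =
       \int[Q]_y (\1_N y)%:E.
  apply: (iid_law_coord i (g := EFin \o \1_N)) => [|y]; last by rewrite lee_fin.
  exact/measurable_EFinP/measurable_indic.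
by rewrite !integral_indic// !setIT => ->.
Qed.

Lemma iid_law_prod n (g : Y -> R) :
  measurable_fun setT g -> (forall y, (0 <= g y)%R) ->
  \int[PP]_x (\prod_(i < n) g (x i))%:E = (\int[Q]_y (g y)%:E) ^+ n.
Proof.
move=> mg g0; have mprod m :
    measurable_fun setT (fun x : seq_space Y => \prod_(i < m) g (x i))%R.
  by apply: measurable_prod => i _; exact: (measurableT_comp mg (measurable_coord i)).
elim: n => [|n IH].
  rewrite expe0 -[RHS](probability_setT PP) -[RHS]mul1e -integral_cst//.
  by apply: eq_integral => x _; rewrite big_ord0.
under eq_integral do rewrite big_ord_recl.
rewrite [LHS](iid_law_peel (F := fun z => (g z.1 * \prod_(i < n) g (z.2 i))%:E))//.
- transitivity (\int[Q]_y ((g y)%:E * (\int[Q]_z (g z)%:E) ^+ n)).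
    apply: eq_integral => y _; rewrite -IH -ge0_integralZl_EFin//.
    + by move=> x _; rewrite lee_fin prodr_ge0.
    + exact/measurable_EFinP.
  rewrite ge0_integralZr//.
  + by rewrite expeS.
  + exact/measurable_EFinP.
  + by move=> y _; rewrite lee_fin.
  + by rewrite expe_ge0// integral_ge0// => y _; rewrite lee_fin.
- apply/measurable_EFinP/measurable_funM; first exact: measurableT_comp.
  exact: (measurableT_comp (mprod n) measurable_snd).
- by move=> z; rewrite lee_fin mulr_ge0// prodr_ge0.
Qed.

End iid.
End sequence_space.

Arguments measurable_seq_shift {dY Y}.

(** * Borel-Cantelli and Markov *)

Section measurability.
Context d (T : measurableType d) (R : realType).

Lemma lim_sup_setP (A : (set T)^nat) x :
  (~ lim_sup_set A x) <-> (\forall n \near \oo, ~ A n x).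
Proof.
split=> [|[N _ AN] LA]; last first.
  by have [j /= Nj Ajx] := LA N I; exact: (AN j).
move=> /existsNP[N /not_implyP[_ NA]]; exists N => // n /= Nn Anx.
by apply: NA; exists n.
Qed.

Lemma measurable_lim_sup_set (A : (set T)^nat) :
  (forall n, measurable (A n)) -> measurable (lim_sup_set A).
Proof.
by move=> mA; apply: bigcap_measurable => // k _; exact: bigcup_measurable.
Qed.

Lemma measurable_gtr (f : T -> R) (c : R) : measurable_fun setT f ->
  measurable [set x | (c < f x)%R].
Proof.
move=> mf; rewrite (_ : [set x | _] = f @^-1` `]c, +oo[%classic).
  by rewrite -[X in measurable X]setTI; exact: mf.
by apply/seteqP; split=> x /=; rewrite in_itv/= andbT.
Qed.

Lemma measurable_ger (f : T -> R) (c : R) : measurable_fun setT f ->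
  measurable [set x | (c <= f x)%R].
Proof.
move=> mf; rewrite (_ : [set x | _] = f @^-1` `[c, +oo[%classic).
  by rewrite -[X in measurable X]setTI; exact: mf.
by apply/seteqP; split=> x /=; rewrite in_itv/= andbT.
Qed.

Lemma integral_probability_cst (P : probability T R) (k : \bar R) :
  \int[P]_x k = k.
Proof.
by rewrite -[RHS]mule1 -(probability_setT P) -(integral_cst P measurableT).
Qed.

End measurability.

Section borel_cantelli_geometric.
Context d (T : measurableType d) (R : realType) (P : {measure set T -> \bar R}).

Lemma borel_cantelli_geometric (A : (set T)^nat) (q : R) :
  (forall n, measurable (A n)) -> (0 <= q)%R -> (q < 1)%R ->
  (\forall n \near \oo, P (A n) <= (q ^+ n)%:E) ->
  {ae P, forall x, \forall n \near \oo, ~ A n x}.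
Proof.
move=> mA q0 q1 [N _ Aq].
(* Emptying the events before [N] makes the geometric bound hold for every [n]. *)
pose B n := if (n < N)%N then set0 else A n.
have mB n : measurable (B n) by rewrite /B; case: ifP.
have B0 : P (lim_sup_set B) = 0.
  apply: lim_sup_set_cvg0 => //.
  apply: (@le_lt_trans _ _ (\sum_(n <oo) (q ^+ n)%:E)).
    apply: lee_nneseries => [n _ _|n _]; first exact: measure_ge0.
    rewrite /B; case: ltnP => nN; last exact: Aq.
    by rewrite measure0 lee_fin exprn_ge0.
  have /cvg_lim lq : series (geometric 1%R q) @ \oo --> (1 * (1 - q)^-1)%R.
    by apply: cvg_geometric_series; rewrite ger0_norm.
  rewrite (_ : limn _ = (1 * (1 - q)^-1)%:E) ?ltry//.
  apply/cvg_lim => //; under eq_fun do rewrite sumEFin.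
  apply/cvg_EFin; first by near=> n.
  apply: cvg_trans (cvg_geometric_series _); last by rewrite ger0_norm.
  apply: near_eq_cvg; near=> n => /=; rewrite /series/=.
  by apply: eq_bigr => i _; rewrite mul1r.
exists (lim_sup_set B); split => //; first exact: measurable_lim_sup_set.
move=> x /= nAx; apply: contrapT => /lim_sup_setP[M _ MB]; apply: nAx.
exists (maxn N M) => // n /=; rewrite geq_max => /andP[Nn Mn] Anx.
by apply: (MB n) => //; rewrite /B ltnNge Nn.
Unshelve. all: by end_near. Qed.

Lemma markov_ge (f : T -> \bar R) (c : R) : measurable_fun setT f ->
  (forall x, 0 <= f x) -> (0 <= c)%R ->
  c%:E * P [set x | c%:E <= f x] <= \int[P]_x f x.
Proof.
move=> mf f0 c0; set A := [set x | _].
have mA : measurable A.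
  by rewrite -[A]setTI; exact: emeasurable_fun_c_infty.
rewrite -[X in P X]setIT -integral_indic// -ge0_integralZl_EFin//; last first.
  exact/measurable_EFinP/measurable_indic.
apply: ge0_le_integral => //.
- by move=> x _; rewrite mule_ge0// lee_fin.
- by apply: measurable_funeM; exact/measurable_EFinP/measurable_indic.
- move=> x _; rewrite indicE; have [/set_mem|_] := boolP (x \in A).
    by rewrite mule1.
  by rewrite mule0.
Qed.

End borel_cantelli_geometric.

(** * One-sided strong law of large numbers *)

Section law_of_large_numbers.
Context (dY : measure_display) (Y : measurableType dY) (R : realType).
Variables (Q : probability Y R) (PP : probability (seq_space Y) R).
Hypothesis QPP : iid_law Q PP.

Lemma measurable_sum_coord (g : Y -> R) n : measurable_fun setT g ->
  measurable_fun setT (fun x : seq_space Y => \sum_(i < n) g (x i))%R.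
Proof.
move=> mg; apply: measurable_sum => i.
exact: (measurableT_comp mg (measurable_coord i)).
Qed.

Section maximal.
Variables (r : Y -> R) (lam : R).
Hypotheses (mr : measurable_fun setT r) (r0 : forall y, (0 <= r y)%R).
Hypothesis lam0 : (0 < lam)%R.

(* max_(k <= n) of the partial sums of r (x i) - lam, computed by peeling x 0 *)
Fixpoint maxsum n (x : seq_space Y) : R :=
  if n is m.+1 then Num.max 0%R (r (x 0%N) - lam + maxsum m (seq_shift x))%R
  else 0%R.

Let maxsum_ge0 n (x : seq_space Y) : (0 <= maxsum n x)%R.
Proof. by case: n => //= n; rewrite le_max lexx. Qed.

Let measurable_maxsum n : measurable_fun setT (maxsum n).
Proof.
elim: n => [|n IH]/=; first exact: measurable_cst.
apply: measurable_maxr => //; apply: measurable_funD.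
  apply: measurable_funB => //.
  exact: (measurableT_comp mr (measurable_coord 0)).
exact: (measurableT_comp IH measurable_seq_shift).
Qed.

Let maxsum_nd n (x : seq_space Y) : (maxsum n x <= maxsum n.+1 x)%R.
Proof.
elim: n x => [|n IH] x; first exact: maxsum_ge0.
rewrite [leLHS]/= [leRHS]/=; have := IH (seq_shift x); rewrite [maxsum n.+1 _]/= => h.
by rewrite ge_max le_max lexx/= le_max lerD2l h orbT.
Qed.

Let maxsum_ge n (x : seq_space Y) : (\sum_(i < n) r (x i) - lam * n%:R <= maxsum n x)%R.
Proof.
elim: n x => [|n IH] x; first by rewrite big_ord0 mulr0 subr0.
rewrite big_ord_recl/= le_max; apply/orP; right.
have := IH (seq_shift x); rewrite -natr1 /seq_shift/= => h.
under eq_bigr do rewrite /bump add1n.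
lra.
Qed.

(** Garsia's argument for the maximal ergodic inequality. Where [maxsum m.+1] is positive it is
    [r (x 0) - lam] plus the shifted [maxsum m]; elsewhere it is 0. Expectations and shift
    invariance give [E maxsum m.+1 + lam * PP (A m.+1) <= E r + E maxsum m], and the maxima cancel
    since they increase with [m]. *)
Let maxsum_markov n :
  lam%:E * PP [set x | (0 < maxsum n x)%R] <= \int[Q]_y (r y)%:E.
Proof.
have [->|rfin] := eqVneq (\int[Q]_y (r y)%:E) +oo; first by rewrite leey.
have rge0 : 0 <= \int[Q]_y (r y)%:E.
  by apply: integral_ge0 => y _; rewrite lee_fin.
have rfn : \int[Q]_y (r y)%:E \is a fin_num.
  by rewrite ge0_fin_numE// lt_neqAle rfin leey.
case: n => [|n].
  rewrite (_ : [set x | _] = set0) ?measure0 ?mule0//.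
  by apply/seteqP; split=> x //=; rewrite ltxx.
pose A m := [set x : seq_space Y | (0 < maxsum m x)%R].
have mA m : measurable (A m) by exact: (measurable_gtr _ (measurable_maxsum m)).
have mEM m : measurable_fun setT (EFin \o maxsum m) by exact/measurable_EFinP.
have EM0 m : 0 <= \int[PP]_x (maxsum m x)%:E.
  by apply: integral_ge0 => x _; rewrite lee_fin.
have mr0 : measurable_fun setT (fun x : seq_space Y => r (x 0%N)).
  exact: (measurableT_comp mr (measurable_coord 0)).
have mMs m : measurable_fun setT (fun x => maxsum m (seq_shift x)).
  exact: (measurableT_comp (measurable_maxsum m) measurable_seq_shift).
have stepE m : \int[PP]_x (r (x 0%N) + maxsum m (seq_shift x))%:E =
    \int[Q]_y (r y)%:E + \int[PP]_x (maxsum m x)%:E.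
  under eq_integral do rewrite EFinD.
  rewrite ge0_integralD//; last 4 first.
  - by move=> x _; rewrite lee_fin.
  - by apply/measurable_EFinP; exact: mr0.
  - by move=> x _; rewrite lee_fin.
  - by apply/measurable_EFinP; exact: mMs.
  congr (_ + _).
    apply: (iid_law_coord QPP 0 (g := EFin \o r)) => [|y]; last by rewrite lee_fin.
    exact/measurable_EFinP.
  apply: (iid_law_shift QPP (F := EFin \o maxsum m)) => //.
  by move=> y; rewrite lee_fin.
have step m : \int[PP]_x (maxsum m.+1 x)%:E + lam%:E * PP (A m.+1) <=
    \int[Q]_y (r y)%:E + \int[PP]_x (maxsum m x)%:E.
  rewrite -stepE -[X in PP X]setIT -integral_indic// -ge0_integralZl_EFin//; last 2 first.
  - exact/measurable_EFinP/measurable_indic.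
  - exact: ltW.
  rewrite -ge0_integralD//; last 4 first.
  - by move=> x _; rewrite lee_fin.
  - exact: mEM.
  - by move=> x _; rewrite mule_ge0// lee_fin// ltW.
  - by apply: measurable_funeM; exact/measurable_EFinP/measurable_indic.
  apply: ge0_le_integral => //.
  - move=> x _; apply: adde_ge0; first by rewrite lee_fin.
    by apply: mule_ge0; rewrite lee_fin// ltW.
  - apply: emeasurable_funD; first exact: mEM.
    by apply: measurable_funeM; exact/measurable_EFinP/measurable_indic.
  - by apply/measurable_EFinP; apply: measurable_funD; [exact: mr0|exact: mMs].
  - move=> x _; rewrite -EFinM -EFinD lee_fin indicE.
    have [/set_mem|] := boolP (x \in A m.+1).
      rewrite /A [X in X -> _]/= [maxsum _ _]/= lt_max ltxx/= => h.
      by rewrite mulr1 (max_r (ltW h)) addrAC subrK.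
    rewrite notin_setE /A [X in X -> _]/= => /negP; rewrite -leNgt => h.
    have -> : (maxsum m.+1 x = 0)%R by apply/eqP; rewrite eq_le h maxsum_ge0.
    by rewrite mulr0 addr0 addr_ge0.
(* Cancelling requires finite expectations, which [step] itself propagates from [m] to [m.+1]. *)
have EMfin m : \int[PP]_x (maxsum m x)%:E \is a fin_num.
  elim: m => [|m IH]; first by rewrite integral0.
  rewrite ge0_fin_numE//; apply: (@le_lt_trans _ _ (\int[Q]_y (r y)%:E +
    \int[PP]_x (maxsum m x)%:E)); last by rewrite ltey_eq fin_numD rfn IH.
  by apply: le_trans (step m); rewrite leeDl// mule_ge0// lee_fin ltW.
have EMnd : \int[PP]_x (maxsum n x)%:E <= \int[PP]_x (maxsum n.+1 x)%:E.
  apply: ge0_le_integral => //.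
  - by move=> x _; rewrite lee_fin.
  - exact: mEM.
  - exact: mEM.
  - by move=> x _; rewrite lee_fin.
have := step n; rewrite addeC -leeBrDr// => /le_trans; apply.
by rewrite leeBlDr// leeD2l.
Qed.

(** The events [0 < maxsum n] increase to a set containing this one, so continuity from below
    applies. *)
Lemma maximal_ineq :
  lam%:E * PP [set x : seq_space Y | exists n, (lam * n%:R < \sum_(i < n) r (x i))%R] <=
  \int[Q]_y (r y)%:E.
Proof.
pose A m := [set x : seq_space Y | (0 < maxsum m x)%R].
have mA m : measurable (A m) by exact: (measurable_gtr _ (measurable_maxsum m)).
pose B := [set x : seq_space Y | exists n, (lam * n%:R < \sum_(i < n) r (x i))%R].
have mB : measurable B.
  rewrite (_ : B = \bigcup_n [set x : seq_space Y | (lam * n%:R < \sum_(i < n) r (x i))%R]).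
    apply: bigcup_measurable => n _.
    exact: (measurable_gtr _ (measurable_sum_coord n mr)).
  by apply/seteqP; split=> x [n]; [exists n|move=> _; exists n].
have BA : B `<=` \bigcup_n A n.
  move=> x [n h]; exists n => //; rewrite /A/=.
  by apply: lt_le_trans (maxsum_ge n x); rewrite subr_gt0.
apply: (@le_trans _ _ (lam%:E * PP (\bigcup_n A n))).
  rewrite lee_pmul2l//; apply: le_measure => //; rewrite ?inE//.
  exact: bigcup_measurable.
have ndA : nondecreasing_seq A.
  apply/nondecreasing_seqP => n; apply/subsetPset => x; rewrite /A/=.
  by move=> /lt_le_trans; apply; exact: maxsum_nd.
have cA := nondecreasing_cvg_mu (mu := PP) mA (bigcup_measurable (fun n _ => mA n)) ndA.
have cA' := cvgeZl (y := lam%:E) isT cA.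
rewrite -(cvg_lim _ cA')//; apply: lime_le; first exact: cvgP cA'.
by apply: nearW => n /=; exact: maxsum_markov.
Qed.

End maximal.

(** [exp u <= 1 / (1 - u)], and [(1 - u) * (1 + u + 2 * u ^+ 2) = 1 + u ^+ 2 * (1 - 2 * u)]. *)
Lemma expR_le_quadratic (u : R) : (u <= 2^-1)%R ->
  (expR u <= 1 + u + 2 * u ^+ 2)%R.
Proof.
move=> u2; have h := expR_ge1Dx (- u)%R.
have u1 : (0 < 1 - u)%R by lra.
have -> : expR u = (expR (- u))^-1%R by rewrite expRN invrK.
apply: (@le_trans _ _ (1 - u)^-1%R).
  by rewrite lef_pV2// ?posrE ?expR_gt0.
rewrite -[leLHS]mul1r ler_pdivrMr//.
have : (0 <= u ^+ 2 * (1 - 2 * u))%R by rewrite mulr_ge0 ?sqr_ge0//; lra.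
by rewrite !expr2 => ?; lra.
Qed.

(** Chernoff's method: for a small [t > 0] the mean of [exp (t * z)] is below 1, so positive sums
    have geometrically small probability. *)
Lemma lln_bounded (z : Y -> R) (B : R) : measurable_fun setT z ->
  (forall y, (`|z y| <= B)%R) -> \int[Q]_y (z y)%:E < 0 ->
  {ae PP, forall x : seq_space Y, \forall n \near \oo, (\sum_(i < n) z (x i) <= 0)%R}.
Proof.
move=> mz zB; have iz : Q.-integrable setT (EFin \o z).
  apply: (@le_integrable _ _ _ _ _ measurableT _ (EFin \o cst B)) => //.
  - exact/measurable_EFinP.
  - move=> y _ /=; rewrite lee_fin; apply: le_trans (zB y) _; exact: ler_norm.
  - exact: finite_measure_integrable_cst.
have zfin : \int[Q]_y (z y)%:E \is a fin_num by exact: integrable_fin_num.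
rewrite -(fineK zfin) lte_fin; set m := fine _ => m0.
have B0 : (0 < B + 1)%R.
  by have := zB point; have := normr_ge0 (z point); lra.
pose C := (B + 1)%R.
have zC y : (`|z y| <= C)%R by apply: le_trans (zB y) _; rewrite /C; lra.
(* The first bound keeps [t * z] below 1/2, where the quadratic estimate holds; the second makes its
   last term [2 * (t * C) ^+ 2] at most [- t * m / 2]. *)
pose t := Num.min (2 * C)^-1%R (- m / (4 * C ^+ 2))%R.
have C2 : (0 < C ^+ 2)%R by rewrite exprn_gt0.
have t0 : (0 < t)%R.
  rewrite /t lt_min invr_gt0 mulr_gt0//= divr_gt0 ?oppr_gt0//; lra.
have t1 : (t * C <= 2^-1)%R.
  by rewrite -ler_pdivlMr// -invfM ge_min lexx.
have t2 : (t * (4 * C ^+ 2) <= - m)%R.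
  rewrite -ler_pdivlMr; last by rewrite mulr_gt0.
  by rewrite /t ge_min lexx orbT.
have rho : \int[Q]_y (expR (t * z y))%:E <= (1 + t * m / 2)%:E.
  have iq : Q.-integrable setT (fun y => (1 + t * z y + 2 * (t * C) ^+ 2)%:E).
    under eq_fun do rewrite 2!EFinD EFinM.
    apply: integrableD => //; last exact: finite_measure_integrable_cst.
    apply: integrableD => //; first exact: finite_measure_integrable_cst.
    exact: integrableZl.
  apply: (@le_trans _ _ (\int[Q]_y (1 + t * z y + 2 * (t * C) ^+ 2)%:E)).
    apply: ge0_le_integral => //.
    - apply/measurable_EFinP; apply: measurableT_comp => //.
      exact: measurable_funM.
    - exact: measurable_int iq.
    - move=> y _; rewrite lee_fin.
      have tz : (`|t * z y| <= t * C)%R.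
        by rewrite normrM gtr0_norm// ler_pM2l.
      apply: (le_trans (expR_le_quadratic _)).
        by apply: le_trans t1; apply: le_trans tz; exact: ler_norm.
      rewrite lerD2l ler_pM2l// -[leLHS]real_normK ?num_real//.
      by rewrite lerXn2r// nnegrE ?mulr_ge0// ltW.
  under eq_integral do rewrite 2!EFinD EFinM.
  rewrite integralD//; last 2 first.
  - apply: integrableD => //; first exact: finite_measure_integrable_cst.
    exact: integrableZl.
  - exact: finite_measure_integrable_cst.
  rewrite integralD//; last 2 first.
  - exact: finite_measure_integrable_cst.
  - exact: integrableZl.
  rewrite integralZl// -(fineK zfin) -/m !integral_probability_cst.
  rewrite -EFinM -!EFinD lee_fin exprMn.
  have : (t * (t * (4 * C ^+ 2)) <= t * - m)%R by rewrite ler_pM2l.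
  by rewrite !expr2; lra.
have tm : (t * m < 0)%R by rewrite nmulr_llt0.
have rho0 : (0 <= 1 + t * m / 2)%R.
  rewrite -lee_fin; apply: le_trans rho; apply: integral_ge0 => y _.
  by rewrite lee_fin expR_ge0.
pose A n := [set x : seq_space Y | (0 < \sum_(i < n) z (x i))%R].
have mA n : measurable (A n) by exact: (measurable_gtr _ (measurable_sum_coord n mz)).
have := @borel_cantelli_geometric _ _ R PP A (1 + t * m / 2)%R mA rho0.
case; first lra.
  apply: nearW => n.
  have mE : measurable_fun setT (fun y => expR (t * z y)).
    by apply: measurableT_comp => //; exact: measurable_funM.
  have mP : measurable_fun setT
      (fun x : seq_space Y => (\prod_(i < n) expR (t * z (x i)))%:E).
    apply/measurable_EFinP/measurable_prod => i _.
    exact: (measurableT_comp mE (measurable_coord i)).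
  have P0 (x : seq_space Y) : 0 <= (\prod_(i < n) expR (t * z (x i)))%:E.
    by rewrite lee_fin prodr_ge0// => i _; exact: expR_ge0.
  have := markov_ge PP mP P0 (@ler01 R); rewrite mul1e => /(le_trans _) h.
  apply: (@le_trans _ _ ((\int[Q]_y (expR (t * z y))%:E) ^+ n)); last first.
    have r0 : 0 <= \int[Q]_y (expR (t * z y))%:E.
      by apply: integral_ge0 => y _; rewrite lee_fin expR_ge0.
    have rf : \int[Q]_y (expR (t * z y))%:E \is a fin_num.
      by rewrite ge0_fin_numE// (le_lt_trans rho)// ltry.
    rewrite -(fineK rf) -EFin_expe lee_fin lerXn2r// ?nnegrE ?fine_ge0//.
    by rewrite -lee_fin fineK.
  rewrite -(iid_law_prod QPP n mE) => [|y]; last exact: expR_ge0.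
  apply: h; apply: le_measure; rewrite ?inE//.
    by rewrite -[X in measurable X]setTI; exact: emeasurable_fun_c_infty.
  move=> x /= zx; rewrite lee_fin -expR_sum -mulr_sumr -[leLHS]expR0 ler_expR.
  by rewrite mulr_ge0// ltW.
move=> N [mN N0 NA]; exists N; split => //.
apply: subset_trans NA => x /= nx H; apply: nx; apply: filterS H => n.
by rewrite /A/= => /negP; rewrite -leNgt.
Qed.

(* The part of z above a level M has small mean, so that the maximal inequality
   controls all its averages at once, and the rest is bounded. *)
Lemma lln_upper (z : Y -> R) (c : R) : measurable_fun setT z ->
  Q.-integrable setT (EFin \o z) -> \int[Q]_y (z y)%:E < c%:E ->
  {ae PP, forall x : seq_space Y, \forall n \near \oo, (\sum_(i < n) z (x i) <= c * n%:R)%R}.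
Proof.
move=> mz iz; have zfin : \int[Q]_y (z y)%:E \is a fin_num.
  exact: integrable_fin_num.
rewrite -(fineK zfin) lte_fin; set m := fine _ => mc.
(* So [c = m + 4 * e]. The truncation [b M] will take at most [m + e] per observation, and the
   excess [r M] is tested against [e]. *)
pose e := ((c - m) / 4)%R; have e0 : (0 < e)%R by rewrite divr_gt0// subr_gt0.
pose b (M : nat) y : R := Num.max (- M%:R)%R (Num.min (z y) M%:R).
pose r (M : nat) y : R := Num.max 0%R (z y - M%:R)%R.
have mb M : measurable_fun setT (b M).
  by apply: measurable_maxr => //; exact: measurable_minr.
have mr M : measurable_fun setT (r M).
  by apply: measurable_maxr => //; exact: measurable_funB.
(* Cutting [z] off below only raises it, so an upper bound involves no lower excess. *)
have zbr M y : (z y <= b M y + r M y)%R.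
  have M0 : (0 <= M%:R :> R)%R by [].
  by rewrite /b /r !maxEle !minEle; do !case: ifPn; rewrite -?ltNge; lra.
have bz M y : (`|b M y| <= `|z y|)%R.
  have M0 : (0 <= M%:R :> R)%R by [].
  rewrite ler_norml /b !maxEle !minEle.
  have := ler_norm (z y); have := ler_norm (- z y); rewrite normrN.
  by do !case: ifPn; rewrite -?ltNge; lra.
have bM M y : (`|b M y| <= M%:R)%R.
  have M0 : (0 <= M%:R :> R)%R by [].
  rewrite ler_norml /b !maxEle !minEle.
  by do !case: ifPn; rewrite -?ltNge; lra.
have rz M y : (`|r M y| <= `|z y|)%R.
  have M0 : (0 <= M%:R :> R)%R by [].
  rewrite ler_norml /r !maxEle.
  have := ler_norm (z y); have := ler_norm (- z y); rewrite normrN.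
  by do !case: ifPn; rewrite -?ltNge; lra.
have large y : \forall M \near \oo, (`|z y| <= M%:R)%R.
  near=> M; apply/ltW; apply: (lt_le_trans (archi_boundP (normr_ge0 (z y)))).
  by rewrite ler_nat; near: M; exact: nbhs_infty_ge.
have cb : \int[Q]_y (b M y)%:E @[M --> \oo] --> \int[Q]_y (z y)%:E.
  apply: (@dominated_cvg _ _ _ Q setT measurableT _ (EFin \o z) (abse \o (EFin \o z))) => //.
  - by move=> M; exact/measurable_EFinP.
  - move=> y _; apply/cvg_EFin; first by near=> M.
    apply: cvg_near_cst; near=> M.
    have : (`|z y| <= M%:R)%R by near: M; exact: large.
    rewrite ler_norml => /andP[h1 h2] /=.
    by rewrite /b min_l// max_r.
  - exact: integrable_abse.
  - by move=> M y _ /=; rewrite lee_fin.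
have cr : \int[Q]_y (r M y)%:E @[M --> \oo] --> \int[Q]_y (cst 0 y).
  apply: (@dominated_cvg _ _ _ Q setT measurableT _ (cst 0) (abse \o (EFin \o z))) => //.
  - by move=> M; exact/measurable_EFinP.
  - move=> y _; apply/cvg_EFin; first by near=> M.
    apply: cvg_near_cst; near=> M.
    have : (`|z y| <= M%:R)%R by near: M; exact: large.
    rewrite ler_norml => /andP[h1 h2] /=.
    by rewrite /r max_l// subr_le0.
  - exact: integrable_abse.
  - by move=> M y _ /=; rewrite lee_fin.
rewrite integral0 in cr.
pose A n := [set x : seq_space Y | (c * n%:R < \sum_(i < n) z (x i))%R].
have mA n : measurable (A n).
  exact: (measurable_gtr _ (measurable_sum_coord n mz)).
have mLA := measurable_lim_sup_set mA.
suff LA0 : PP (lim_sup_set A) = 0.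
  exists (lim_sup_set A); split => // x /= nx; apply: contrapT => /lim_sup_setP H.
  by apply: nx; apply: filterS H => n /negP; rewrite -leNgt.
(* Eventually the sums of [b M] are at most [(m + e) * n], so on the limsup event some sum of [r M]
   exceeds [e * n], and the maximal inequality applies. Letting [M] grow then sends the mean of
   [r M] to 0. *)
have bnd M : \int[Q]_y (b M y)%:E < (m + e)%:E ->
    e%:E * PP (lim_sup_set A) <= \int[Q]_y (r M y)%:E.
  move=> bMm; have r0 y : (0 <= r M y)%R by rewrite le_max lexx.
  apply: le_trans (maximal_ineq (mr M) r0 e0).
  rewrite lee_pmul2l//.
  have bb : \int[Q]_y (b M y - (m + e))%:E < 0.
    under eq_integral do rewrite EFinB.
    have ib : Q.-integrable setT (EFin \o b M).
      apply: (@le_integrable _ _ _ _ _ measurableT _ (EFin \o z)) => //.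
      - exact/measurable_EFinP.
      - by move=> y _ /=; rewrite lee_fin.
    rewrite integralB//; last exact: finite_measure_integrable_cst.
    have bf : \int[Q]_y (b M y)%:E \is a fin_num by exact: integrable_fin_num.
    rewrite integral_probability_cst -(fineK bf) -EFinB lte_fin subr_lt0.
    by rewrite -lte_fin fineK.
  have [||N [mN N0 NA]] := lln_bounded (B := (M%:R + `|m + e|)%R) _ _ bb.
  - exact: measurable_funB.
  - by move=> y; apply: (le_trans (ler_normB _ _)); rewrite lerD2r.
  set E := [set x : seq_space Y | _].
  have mE : measurable E.
    rewrite (_ : E = \bigcup_n [set x : seq_space Y |
        (e * n%:R < \sum_(i < n) r M (x i))%R]).
      apply: bigcup_measurable => n _.
      exact: (measurable_gtr _ (measurable_sum_coord n (mr M))).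
    by apply/seteqP; split=> x [n]; [exists n|move=> _; exists n].
  apply: (@le_trans _ _ (PP (E `|` N))); last first.
    by rewrite -[leRHS]adde0 -N0; exact: measureU2.
  apply: le_measure; rewrite ?inE//; first exact: measurableU.
  move=> x LAx; have [Nx|nNx] := pselect (N x); [by right|left].
  have [k _ kb] : \forall n \near \oo, (\sum_(i < n) (b M (x i) - (m + e)) <= 0)%R.
    by apply: contrapT => H; apply: nNx; exact: NA.
  have [n /= kn] := LAx k I; rewrite /A/= => nz.
  exists n; have := kb n kn; rewrite sumrB sumr_const card_ord => h.
  have : (\sum_(i < n) z (x i) <= \sum_(i < n) b M (x i) + \sum_(i < n) r M (x i))%R.
    by rewrite -big_split/=; apply: ler_sum => i _; exact: zbr.
  move: h nz; rewrite -mulr_natr.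
  have -> : c = (m + 4 * e)%R by rewrite /e; field.
  have n0 : (0 <= n%:R :> R)%R by [].
  have en : (0 <= e * n%:R)%R by rewrite mulr_ge0// ltW.
  by rewrite !mulrDl; lra.
apply/eqP; rewrite eq_le measure_ge0 andbT.
rewrite -(@lee_pmul2l _ e%:E)// mule0 -(cvg_lim _ cr)//.
apply: lime_ge; first exact: cvgP cr.
have : \forall M \near \oo, \int[Q]_y (b M y)%:E < (m + e)%:E.
  move: cb; rewrite -(fineK zfin) -/m => cb.
  have me : nbhs m%:E [set x : \bar R | x < (m + e)%:E].
    apply: open_nbhs_nbhs; split; first exact: open_ereal_lt_ereal.
    by rewrite /= lte_fin ltrDl.
  exact: (cb _ me).
by apply: filterS => M /bnd.
Unshelve. all: by end_near. Qed.

End law_of_large_numbers.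

(** * The minimax exponent *)

Section minimax.
Context (R : realType).

Definition in01 (a : R) := (0 <= a <= 1)%R.

Section two_functions.
Variables (H1 H2 : R -> \bar R) (c0 c : R).
Hypotheses (c00 : (0 < c0)%R) (c0c : (c0 < c)%R).
Hypotheses (H1_ge0 : forall a, 0 <= H1 a) (H2_ge0 : forall a, 0 <= H2 a).
Hypothesis H1_convex : forall t a b, in01 t -> in01 a -> in01 b ->
  H1 (t * a + (1 - t) * b)%R <= t%:E * H1 a + (1 - t)%:E * H1 b.
Hypothesis H2_convex : forall t a b, in01 t -> in01 a -> in01 b ->
  H2 (t * a + (1 - t) * b)%R <= t%:E * H2 a + (1 - t)%:E * H2 b.
Hypothesis H12 : forall a, in01 a -> H1 a <= c%:E -> H2 a <= c%:E -> False.

Let p a := fine (H1 a).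
Let q a := fine (H2 a).

Let pE a : H1 a < +oo -> H1 a = (p a)%:E.
Proof. by move=> h; rewrite fineK// ge0_fin_numE. Qed.

Let qE a : H2 a < +oo -> H2 a = (q a)%:E.
Proof. by move=> h; rewrite fineK// ge0_fin_numE. Qed.

(** Think of the points [(H1 a, H2 a)] in the plane. If the inequality failed, the segment joining
    the points of [a] and [b] would meet the box where both coordinates are at most [c]. The weight
    [l] puts the first coordinate exactly at [c], and convexity transfers this to the exponent
    [l * a + (1 - l) * b], against [H12]. *)
Let slope_le a b : in01 a -> in01 b -> H1 a < c%:E -> H2 a < +oo ->
  H2 b < c%:E -> H1 b < +oo -> ((c - q b) / (p b - c) <= (q a - c) / (c - p a))%R.
Proof.
move=> a01 b01 h1a h2a h2b h1b.
have ha := pE (lt_trans h1a (ltry _)); have hb := qE (lt_trans h2b (ltry _)).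
have ha2 := qE h2a; have hb1 := pE h1b.
have pac : (p a < c)%R by rewrite -lte_fin -ha.
have qbc : (q b < c)%R by rewrite -lte_fin -hb.
have qac : (c < q a)%R.
  by rewrite ltNge; apply/negP; rewrite -lee_fin -ha2; apply: (H12 a01); exact: ltW.
have pbc : (c < p b)%R.
  rewrite ltNge; apply/negP; rewrite -lee_fin -hb1 => h.
  by apply: (H12 b01 h); exact: ltW.
rewrite leNgt; apply/negP.
rewrite ltr_pdivrMr ?subr_gt0// mulrAC ltr_pdivlMr ?subr_gt0// => h.
have pp : (0 < p b - p a)%R by lra.
pose l := ((p b - c) / (p b - p a))%R.
have l1 : (1 - l = (c - p a) / (p b - p a))%R by rewrite /l; field; apply: lt0r_neq0; lra.
have l01 : in01 l.
  rewrite /in01 -subr_ge0 -[X in _ && X]subr_ge0 subr0 l1.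
  by apply/andP; split; apply: divr_ge0; lra.
have g01 : in01 (l * a + (1 - l) * b)%R.
  move: l01 a01 b01 => /andP[? ?] /andP[? ?] /andP[? ?].
  by apply/andP; split; nra.
apply: (H12 g01).
  apply: (le_trans (H1_convex l01 a01 b01)).
  rewrite ha hb1 -!EFinM -EFinD lee_fin l1 /l.
  rewrite [leLHS](_ : _ = c)//; field; apply: lt0r_neq0; lra.
apply: (le_trans (H2_convex l01 a01 b01)).
rewrite ha2 hb -!EFinM -EFinD lee_fin l1 /l.
rewrite -(ler_pM2r pp).
rewrite [leLHS](_ : _ = (p b - c) * q a + (c - p a) * q b)%R; last by field; apply: lt0r_neq0; lra.
nra.
Qed.

(** The line [s0 * x + y = (1 + s0) * c] through the corner of the box separates it from the finite
    points [(H1 a, H2 a)]. The exponent [a0], where [H2] is finite, bounds the slopes whose supremum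
    is [s0]. *)
Lemma two_functions_asym a0 b0 : in01 a0 -> in01 b0 ->
  H1 a0 < c%:E -> H2 a0 < +oo ->
  exists2 t, in01 t & forall a, in01 a -> c0%:E <= t%:E * H1 a + (1 - t)%:E * H2 a.
Proof.
move=> a001 b001 h1 h2.
pose E := [set 0%R] `|` [set ((c - q b) / (p b - c))%R | b in
  [set b | [/\ in01 b, H2 b < c%:E & H1 b < +oo]]].
have Eub a : in01 a -> H1 a < c%:E -> H2 a < +oo ->
    ubound E ((q a - c) / (c - p a))%R.
  move=> a01 h1a h2a x [->|[b [b01 h2b h1b] <-]]; last exact: slope_le.
  have pac : (p a < c)%R by rewrite -lte_fin -pE// (lt_trans h1a (ltry _)).
  apply: divr_ge0; last by lra.
  rewrite subr_ge0 leNgt; apply/negP => qac; apply: (H12 a01 (ltW h1a)).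
  by rewrite qE// lee_fin ltW.
have E0 : E !=set0 by exists 0%R; left.
have Eu : has_ubound E by exists ((q a0 - c) / (c - p a0))%R; exact: Eub.
pose s0 := sup E.
have s00 : (0 <= s0)%R by apply: ub_le_sup => //; left.
(* With [s0 = 0] the weight of [H1] would vanish even where [H1] is infinite, so [s0] is raised by
   [sg]. The gap between the levels pays for it: [(1 + s0 + sg) * c0 = (1 + s0) * c]. *)
pose sg : R := ((1 + s0) * (c - c0) / c0)%R.
have s01 : (0 < 1 + s0)%R by lra.
have sg0 : (0 < sg)%R by rewrite /sg divr_gt0// mulr_gt0// subr_gt0.
have sgE : (sg * c0 = (1 + s0) * (c - c0))%R by rewrite /sg mulfVK// gt_eqF.
pose s := (s0 + sg)%R.
have s1 : (0 < 1 + s)%R by rewrite /s; lra.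
pose t := (s / (1 + s))%R.
have t0 : (0 < t)%R by rewrite /t divr_gt0// /s; lra.
have t1 : (1 - t = (1 + s)^-1)%R by rewrite /t; field; apply: lt0r_neq0; lra.
have t10 : (0 < 1 - t)%R by rewrite t1 invr_gt0.
exists t; first by apply/andP; split; lra.
move=> a a01.
have [h1a|h1a] := boolP (H1 a < +oo); last first.
  have -> : H1 a = +oo by apply/eqP; rewrite -leye_eq leNgt.
  rewrite gt0_muley ?lte_fin// addye ?leey//.
  by rewrite gt_eqF// (lt_le_trans (ltNyr 0%R))// mule_ge0// lee_fin ltW.
have [h2a|h2a] := boolP (H2 a < +oo); last first.
  have -> : H2 a = +oo by apply/eqP; rewrite -leye_eq leNgt.
  rewrite gt0_muley ?lte_fin// addey ?leey//.
  by rewrite gt_eqF// (lt_le_trans (ltNyr 0%R))// mule_ge0// lee_fin ltW.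
have p0 : (0 <= p a)%R by rewrite fine_ge0.
rewrite pE// qE// -!EFinM -EFinD lee_fin.
suff h : ((1 + s) * c0 <= s * p a + q a)%R.
  rewrite t1 /t -(ler_pM2l s1) (le_trans h)//.
  by rewrite le_eqVlt; apply/orP; left; apply/eqP; field; apply: lt0r_neq0; lra.
have [pac|pac] := ltP (p a) c.
  have h1ac : H1 a < c%:E by rewrite pE// lte_fin.
  have : (s0 <= (q a - c) / (c - p a))%R by apply: ge_sup => //; exact: Eub.
  rewrite ler_pdivlMr ?subr_gt0// => h.
  have : (0 <= sg * p a)%R by rewrite mulr_ge0// ltW.
  by rewrite /s !mulrDl; lra.
have [qac|qac] := ltP (q a) c; last first.
  by rewrite /s; nra.
have pac' : (c < p a)%R.
  rewrite lt_neqAle pac andbT; apply/negP => /eqP cp; apply: (H12 a01).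
    by rewrite pE// -cp.
  by rewrite qE// lee_fin ltW.
have : ((c - q a) / (p a - c) <= s0)%R.
  by apply: ub_le_sup => //; right; exists a => //; split => //; rewrite qE// lte_fin.
rewrite ler_pdivrMr ?subr_gt0// => h.
have : (0 <= sg * p a)%R by rewrite mulr_ge0// ltW.
by rewrite /s !mulrDl; lra.
Qed.

End two_functions.

Section family.
Context (T : Type) (A : set T) (H : T -> R -> \bar R) (c0 c : R).
Hypotheses (c00 : (0 < c0)%R) (c0c : (c0 < c)%R).
Hypothesis H_ge0 : forall f a, A f -> 0 <= H f a.
Hypothesis H_convex : forall f t a b, A f -> in01 t -> in01 a -> in01 b ->
  H f (t * a + (1 - t) * b)%R <= t%:E * H f a + (1 - t)%:E * H f b.
Hypothesis H_fin : forall f a b, A f -> in01 a -> in01 b -> (a <= b)%R ->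
  H f b < +oo -> H f a < +oo.
Hypothesis H_lsc : forall f (u : nat -> R) a, A f -> (forall n, in01 (u n)) ->
  in01 a -> u @ \oo --> a -> (forall n, H f (u n) <= c%:E) -> H f a <= c%:E.
Hypothesis H_concave : forall f g t, A f -> A g -> in01 t ->
  exists2 h, A h & forall a, in01 a ->
    t%:E * H f a + (1 - t)%:E * H g a <= H h a.
Hypothesis H_small : forall f, A f -> exists2 a, in01 a & H f a < c0%:E.

(** If the sublevel sets were disjoint, a weighted sum of [H f] and [H g] would stay above [c0], and
    so would [H h] for a mixture [h], against [H_small]. The separation starts from an exponent
    where both functions are finite. By [H_fin] the smaller of [a0] and [b0] is one; when [H g a0]
    is infinite that is [b0], and [f] and [g] exchange roles. *)
Let common f g : A f -> A g ->
  exists a, [/\ in01 a, H f a <= c%:E & H g a <= c%:E].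
Proof.
move=> Af Ag; apply: contrapT => nex.
have [a0 a001 fa0] := H_small Af; have [b0 b001 gb0] := H_small Ag.
have fa0c : H f a0 < c%:E by apply: (lt_trans fa0); rewrite lte_fin.
have gb0c : H g b0 < c%:E by apply: (lt_trans gb0); rewrite lte_fin.
have notmix h : A h -> (forall a, in01 a -> c0%:E <= H h a) -> False.
  by move=> Ah hc; have [a a01] := H_small Ah; rewrite ltNge hc.
have [ga0|ga0] := boolP (H g a0 < +oo).
  have [|||||t t01 tc] := @two_functions_asym (H f) (H g) c0 c c00 c0c _ _ _ _ _
      a0 b0 a001 b001 fa0c ga0.
  - by move=> a; exact: H_ge0.
  - by move=> a; exact: H_ge0.
  - by move=> t a b; exact: H_convex.
  - by move=> t a b; exact: H_convex.
  - by move=> a a01 fa ga; apply: nex; exists a.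
  have [h Ah hle] := H_concave Af Ag t01.
  by apply: (notmix h Ah) => a a01; apply: le_trans (hle a a01); exact: tc.
have fb0 : H f b0 < +oo.
  have [ab|ba] := leP a0 b0.
    exfalso; move: ga0; rewrite (H_fin Ag a001 b001 ab)//.
    exact: lt_trans gb0c (ltry _).
  by apply: (H_fin Af b001 a001 (ltW ba)); exact: lt_trans fa0c (ltry _).
have [|||||t t01 tc] := @two_functions_asym (H g) (H f) c0 c c00 c0c _ _ _ _ _
    b0 a0 b001 a001 gb0c fb0.
- by move=> a; exact: H_ge0.
- by move=> a; exact: H_ge0.
- by move=> t a b; exact: H_convex.
- by move=> t a b; exact: H_convex.
- by move=> a a01 ga fa; apply: nex; exists a.
have [h Ah hle] := H_concave Ag Af t01.
by apply: (notmix h Ah) => a a01; apply: le_trans (hle a a01); exact: tc.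
Qed.

(* Helly's theorem on the line, applied to the intervals {a | H f a <= c}. *)
Lemma minimax_family : exists2 a, in01 a & forall f, A f -> H f a <= c%:E.
Proof.
have z01 : in01 0%R by rewrite /in01 lexx ler01.
have [[g0 Ag0]|nA] := pselect (exists f, A f); last first.
  by exists 0%R => // f Af; exfalso; apply: nA; exists f.
(* [D] holds the exponents to the left of some whole sublevel interval, so [b] is the supremum of
   the left endpoints. *)
pose D := [set x | in01 x /\ exists2 f, A f &
  forall a, in01 a -> H f a <= c%:E -> (x <= a)%R].
have D0 : D 0%R by split=> //; exists g0 => // a /andP[].
have D1 : ubound D 1%R by move=> x [/andP[]].
have Du : has_ubound D by exists 1%R.
pose b := sup D.
have b0 : (0 <= b)%R by exact: ub_le_sup.
have b1 : (b <= 1)%R by apply: ge_sup => //; exists 0%R.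
have b01 : in01 b by rewrite /in01 b0 b1.
exists b => // f Af.
(* Pairwise meeting gives a point [q] of the interval of [f] beyond [b - e], and the choice of [b] a
   point [p] before [b + e]. If neither is close to [b], then [b] lies between them and convexity
   applies. Closedness finally lets [e] tend to 0. *)
have near e : (0 < e)%R ->
    exists a, [/\ in01 a, H f a <= c%:E & (`|b - a| < e)%R].
  move=> e0.
  have [q [q01 fq bq]] : exists q, [/\ in01 q, H f q <= c%:E & (b - e < q)%R].
    have [x [x01 [g Ag gx]] bx] := @sup_adherent _ D e e0 (conj (ex_intro _ 0%R D0) Du).
    have [a [a01 fa ga]] := common Af Ag.
    by exists a; split => //; apply: (lt_le_trans bx); exact: gx.
  have [p [p01 fp pb]] : exists p, [/\ in01 p, H f p <= c%:E & (p < b + e)%R].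
    apply: contrapT => np.
    have big a : in01 a -> H f a <= c%:E -> (b + e <= a)%R.
      by move=> a01 fa; rewrite leNgt; apply/negP => ab; apply: np; exists a.
    have : (b + e <= b)%R; last by lra.
    apply: ub_le_sup => //; split; last by exists f.
    move: (big q q01 fq); move: q01 => /andP[q0 q1] bq1.
    by apply/andP; split; lra.
  have [bp|pb'] := leP b p; first by exists p; split=> //; rewrite ltr_norml; lra.
  have [qb|bq'] := leP q b; first by exists q; split=> //; rewrite ltr_norml; lra.
  exists b; split => //; last by rewrite subrr normr0.
  pose l := ((q - b) / (q - p))%R.
  have qp : (0 < q - p)%R by lra.
  have l01 : in01 l.
    apply/andP; split; first by apply: divr_ge0; lra.
    by rewrite /l ler_pdivrMr//; lra.
  have -> : b = (l * p + (1 - l) * q)%R by rewrite /l; field; apply: lt0r_neq0; lra.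
  apply: (le_trans (H_convex Af l01 p01 q01)).
  have l0 : (0 <= l)%R by case/andP: l01.
  have l1 : (0 <= 1 - l)%R by rewrite subr_ge0; case/andP: l01.
  apply: (@le_trans _ _ (l%:E * c%:E + (1 - l)%:E * c%:E)).
    by apply: leeD; apply: lee_wpmul2l; rewrite ?lee_fin.
  by rewrite -!EFinM -EFinD lee_fin; lra.
have /choice[u uP] : forall n : nat, exists a,
    [/\ in01 a, H f a <= c%:E & (`|b - a| < n.+1%:R^-1)%R].
  by move=> n; apply: near; rewrite invr_gt0.
apply: (H_lsc (u := u) Af) => //; try by move=> n; case: (uP n).
apply/cvgrPdist_lt => e e0; near=> n; have [_ _ h] := uP n.
apply: (lt_trans h); near: n.
exact: near_infty_natSinv_lt (PosNum e0).
Unshelve. all: by end_near. Qed.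

End family.
End minimax.

(** * Powers and moments with [0 ^ 0 = 0] *)

Section power_with_zero.
Context (R : realType).
Implicit Types (a b t x y s : R).

(* x ^ a with 0 ^ 0 = 0, so that a = 0 gives the indicator of x > 0: unlike
   powR, this makes a |-> x ^ a lower semicontinuous at a = 0 when x = 0. *)
Definition pow0 a x : R := if x == 0%R then 0%R else (x `^ a)%R.

Lemma pow00 a : pow0 a 0 = 0%R. Proof. by rewrite /pow0 eqxx. Qed.

Lemma pow0_ge0 a x : (0 <= pow0 a x)%R.
Proof. by rewrite /pow0; case: ifP => // _; exact: powR_ge0. Qed.

Lemma pow0_gt0E a x : (0 < x)%R -> pow0 a x = expR (a * ln x).
Proof. by move=> x0; rewrite /pow0 /powR gt_eqF. Qed.

Lemma pow0_powR a x : a != 0%R -> pow0 a x = (x `^ a)%R.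
Proof. by rewrite /pow0 => a0; case: eqP => // ->; rewrite powR0. Qed.

Lemma pow0M a x y : (0 <= x)%R -> (0 <= y)%R ->
  pow0 a (x * y) = (pow0 a x * pow0 a y)%R.
Proof.
move=> x0 y0; rewrite /pow0 mulf_eq0.
have [_|_] := eqVneq x 0%R; first by rewrite mul0r.
have [_|_] := eqVneq y 0%R; first by rewrite mulr0.
by rewrite powRM.
Qed.

Lemma measurable_pow0 a : measurable_fun setT (pow0 a).
Proof.
rewrite (_ : pow0 a = fun x => (x `^ a * \1_(~` [set 0]) x)%R).
  by apply: measurable_funM => //; apply: measurable_indic; exact: measurableC.
apply/funext => x; rewrite /pow0 indicE; have [->|x0] := eqVneq x 0%R.
  by rewrite memNset ?mulr0//= => /(_ erefl).
by rewrite mem_set ?mulr1//=; exact/eqP.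
Qed.

(** The exponential lies above its tangent at [z]. *)
Lemma pow0_convex t a b x : in01 t -> (0 <= x)%R ->
  (pow0 (t * a + (1 - t) * b) x <= t * pow0 a x + (1 - t) * pow0 b x)%R.
Proof.
move=> /andP[t0 t1]; rewrite le_eqVlt => /predU1P[<-|x0].
  by rewrite !pow00 !mulr0 addr0.
rewrite !pow0_gt0E//; set z := ((t * a + (1 - t) * b) * ln x)%R.
have tangent u : (expR z * (1 + (u - z)) <= expR u)%R.
  rewrite [leRHS](_ : _ = expR z * expR (u - z))%R; last first.
    by rewrite -expRD addrC subrK.
  by rewrite ler_pM2l ?expR_gt0// expR_ge1Dx.
apply: (@le_trans _ _ (t * (expR z * (1 + (a * ln x - z))) +
    (1 - t) * (expR z * (1 + (b * ln x - z))))%R).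
  by rewrite le_eqVlt; apply/orP; left; apply/eqP; rewrite /z; ring.
by apply: lerD; apply: ler_wpM2l; rewrite ?subr_ge0.
Qed.

Lemma pow0_le_affine a x : in01 a -> (0 <= x)%R ->
  (pow0 a x <= a * x + (1 - a))%R.
Proof.
move=> a01 x0; have := pow0_convex 1 0 a01 x0; rewrite mulr1 mulr0 addr0.
move=> /le_trans; apply; case/andP: a01 => a0 a1.
rewrite {1}/pow0 powRr1// lerD//.
  by rewrite ler_wpM2l//; case: eqP => [->|].
rewrite -[leRHS]mulr1 ler_wpM2l ?subr_ge0// /pow0; case: ifP => // _.
by rewrite powRr0.
Qed.

(** [pow0_le_affine] at [u / z], scaled by [pow0 a z], bounds [u ^ a] by its tangent at [z].
    Averaging these bounds over [x] and [y], whose mean is [z], gives [pow0 a z]. *)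
Lemma pow0_concave t a x y : in01 t -> in01 a -> (0 <= x)%R -> (0 <= y)%R ->
  (t * pow0 a x + (1 - t) * pow0 a y <= pow0 a (t * x + (1 - t) * y))%R.
Proof.
move=> /andP[t0 t1] a01 x0 y0.
have tx0 : (0 <= t * x)%R by exact: mulr_ge0.
have ty0 : (0 <= (1 - t) * y)%R by rewrite mulr_ge0// subr_ge0.
have [z0|z0] := eqVneq (t * x + (1 - t) * y)%R 0%R.
  rewrite z0 pow00; move/eqP: z0; rewrite paddr_eq0// !mulf_eq0.
  move=> /andP[/orP[]/eqP-> /orP[]/eqP->]; rewrite ?pow00 ?mul0r ?mulr0 ?addr0//.
set z := (_ + _)%R in z0 *; have zgt : (0 < z)%R by rewrite lt_neqAle eq_sym z0 addr_ge0.
have bound u : (0 <= u)%R -> (pow0 a u <= pow0 a z * (a * (u / z) + (1 - a)))%R.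
  move=> u0; have uz : (0 <= u / z)%R by rewrite divr_ge0// ltW.
  rewrite [leLHS](_ : _ = pow0 a (z * (u / z))); last by rewrite mulrC divfK.
  by rewrite pow0M// ?(ltW zgt)// ler_wpM2l ?pow0_ge0// pow0_le_affine.
apply: (@le_trans _ _ (t * (pow0 a z * (a * (x / z) + (1 - a))) +
    (1 - t) * (pow0 a z * (a * (y / z) + (1 - a))))%R).
  by apply: lerD; apply: ler_wpM2l; rewrite ?subr_ge0//; exact: bound.
rewrite [leLHS](_ : _ = pow0 a z * (a * (z / z) + (1 - a)))%R.
  by rewrite divff// mulr1 addrC subrK mulr1.
rewrite [RHS](_ : _ = pow0 a z * (a * ((t * x + (1 - t) * y) / z) + (1 - a)))%R//.
by move: (pow0 a z) (z^-1)%R => p iz; ring.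
Qed.

Lemma pow0_le1D a b x : (0 <= a)%R -> (a <= b)%R -> (0 <= x)%R ->
  (pow0 a x <= 1 + pow0 b x)%R.
Proof.
move=> a0 ab; rewrite le_eqVlt => /predU1P[<-|x0]; first by rewrite !pow00 addr0.
rewrite !pow0_gt0E//; have [l0|l0] := leP 0%R (ln x).
  apply: (@le_trans _ _ (expR (b * ln x))); first by rewrite ler_expR ler_wpM2r.
  by rewrite lerDr.
apply: (@le_trans _ _ 1%R); last by rewrite lerDl expR_ge0.
by rewrite -[leRHS]expR0 ler_expR mulr_ge0_le0// ltW.
Qed.

(** The bound is the same for all exponents in [0, 1], which keeps the later tail estimate free of
    the unknown exponent. *)
Lemma pow0_ge_expRN a s x : in01 a -> (0 <= s)%R -> (expR (- s) <= x)%R ->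
  (expR (- s) <= pow0 a x)%R.
Proof.
move=> /andP[a0 a1] s0 sx; have x0 := lt_le_trans (expR_gt0 _) sx.
rewrite pow0_gt0E// ler_expR.
have sl : (- s <= ln x)%R by rewrite -(expRK (- s)%R) ler_ln ?posrE ?expR_gt0.
have [l0|l0] := leP 0%R (ln x).
  by rewrite (@le_trans _ _ 0%R)// ?oppr_le0// mulr_ge0.
apply: (le_trans sl); rewrite -[leLHS]mul1r ler_wnM2r// ltW//.
Qed.

Lemma cvg_pow0 (u : nat -> R) a x : u @ \oo --> a ->
  pow0 (u n) x @[n --> \oo] --> pow0 a x.
Proof.
move=> ua; rewrite /pow0; case: eqP => [_|/eqP x0]; first exact: cvg_cst.
rewrite /powR (negbTE x0).
have uax : (u n * ln x)%R @[n --> \oo] --> (a * ln x)%R.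
  exact: (cvgM ua (cvg_cst _)).
have cexp := @continuous_expR R (a * ln x)%R.
exact: (cvg_comp _ _ uax cexp).
Qed.

End power_with_zero.

Section power_integral.
Context (dY : measure_display) (Y : measurableType dY) (R : realType).
Variable Q : probability Y R.
Implicit Types (g : Y -> R) (a b t : R).

(** At [f / fstar] this is [hstar] for nonzero exponents; at exponent 0 it is the [Q]-mass of the
    set where [g] is nonzero, instead of 1. *)
Definition hpow g a : \bar R := \int[Q]_y (pow0 a (g y))%:E.

Lemma measurable_pow0_comp g a : measurable_fun setT g ->
  measurable_fun setT (fun y => (pow0 a (g y))%:E).
Proof.
by move=> mg; apply/measurable_EFinP; exact: (measurableT_comp (measurable_pow0 a)).
Qed.

Lemma hpow_ge0 g a : 0 <= hpow g a.
Proof. by apply: integral_ge0 => y _; rewrite lee_fin pow0_ge0. Qed.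

Lemma integral_affine (g h : Y -> \bar R) (s t : R) :
  measurable_fun setT g -> measurable_fun setT h ->
  (forall y, 0 <= g y) -> (forall y, 0 <= h y) -> (0 <= s)%R -> (0 <= t)%R ->
  \int[Q]_y (s%:E * g y + t%:E * h y) =
  s%:E * \int[Q]_y g y + t%:E * \int[Q]_y h y.
Proof.
move=> mg mh g0 h0 s0 t0.
rewrite ge0_integralD//.
- by rewrite !ge0_integralZl_EFin.
- by move=> y _; rewrite mule_ge0.
- exact: measurable_funeM.
- by move=> y _; rewrite mule_ge0.
- exact: measurable_funeM.
Qed.

Lemma hpow_convex g t a b : measurable_fun setT g -> (forall y, (0 <= g y)%R) ->
  in01 t -> hpow g (t * a + (1 - t) * b)%R <= t%:E * hpow g a + (1 - t)%:E * hpow g b.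
Proof.
move=> mg g0 t01; case/andP: (t01) => t0 t1.
rewrite -integral_affine ?subr_ge0//; try exact: measurable_pow0_comp;
  try by move=> y; rewrite lee_fin pow0_ge0.
apply: ge0_le_integral => //.
- by move=> y _; rewrite lee_fin pow0_ge0.
- exact: measurable_pow0_comp.
- by apply: emeasurable_funD; apply: measurable_funeM; exact: measurable_pow0_comp.
- by move=> y _; rewrite -!EFinM -EFinD lee_fin pow0_convex.
Qed.

Lemma hpow_concave g (h : Y -> R) t a : measurable_fun setT g -> measurable_fun setT h ->
  (forall y, (0 <= g y)%R) -> (forall y, (0 <= h y)%R) -> in01 t -> in01 a ->
  t%:E * hpow g a + (1 - t)%:E * hpow h a <=
  hpow (fun y => t * g y + (1 - t) * h y)%R a.
Proof.
move=> mg mh g0 h0 t01 a01; case/andP: (t01) => t0 t1.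
rewrite -integral_affine ?subr_ge0//; try exact: measurable_pow0_comp;
  try by move=> y; rewrite lee_fin pow0_ge0.
apply: ge0_le_integral => //.
- by move=> y _; rewrite -!EFinM -EFinD lee_fin addr_ge0// mulr_ge0 ?pow0_ge0 ?subr_ge0.
- by apply: emeasurable_funD; apply: measurable_funeM; exact: measurable_pow0_comp.
- by apply: measurable_pow0_comp; apply: measurable_funD; exact: measurable_funM.
- by move=> y _; rewrite -!EFinM -EFinD lee_fin pow0_concave.
Qed.

Lemma hpow_fin g a b : measurable_fun setT g -> (forall y, (0 <= g y)%R) ->
  (0 <= a)%R -> (a <= b)%R -> hpow g b < +oo -> hpow g a < +oo.
Proof.
move=> mg g0 a0 ab hb; apply: (@le_lt_trans _ _ (1%:E + hpow g b)).
  rewrite -[X in X + _](integral_probability_cst Q) -ge0_integralD//.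
  - apply: ge0_le_integral => //.
    + by move=> y _; rewrite lee_fin pow0_ge0.
    + exact: measurable_pow0_comp.
    + by apply: emeasurable_funD => //; exact: measurable_pow0_comp.
    + by move=> y _; rewrite -EFinD lee_fin pow0_le1D.
  - by move=> y _; rewrite lee_fin pow0_ge0.
  - exact: measurable_pow0_comp.
by rewrite lte_add_pinfty// ltry.
Qed.

(** Fatou's lemma, [pow0] being continuous in its exponent. *)
Lemma hpow_lsc g (u : nat -> R) a (c : R) :
  measurable_fun setT g -> (forall y, (0 <= g y)%R) -> u @ \oo --> a ->
  (forall n, hpow g (u n) <= c%:E) -> hpow g a <= c%:E.
Proof.
move=> mg g0 ua uc.
have mn n := measurable_pow0_comp (u n) mg.
have n0 n y : setT y -> 0 <= (pow0 (u n) (g y))%:E.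
  by move=> _; rewrite lee_fin pow0_ge0.
have := fatou Q measurableT mn n0.
rewrite (_ : \int[Q]_x _ = hpow g a); last first.
  apply: eq_integral => y _; 
  have uy : pow0 (u n) (g y) @[n --> \oo] --> pow0 a (g y) by exact: cvg_pow0.
  have cu : (pow0 (u n) (g y))%:E @[n --> \oo] --> (pow0 a (g y))%:E.
    by apply: cvg_EFin => //; near=> n.
  by rewrite is_cvg_limn_einfE; [exact: cvg_lim|exact: cvgP cu].
move=> /le_trans; apply; rewrite limn_einf_lim.
apply: lime_le; first exact: is_cvg_einfs.
apply: nearW => n; apply: le_trans (uc n).
by apply: ereal_inf_lbound; exists n => /=.
Unshelve. all: by end_near. Qed.

End power_integral.

Section measurable_ratio.
Context d (T : measurableType d) (R : realType).

Lemma measurable_invr_ge0 (g : T -> R) : measurable_fun setT g ->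
  (forall x, (0 <= g x)%R) -> measurable_fun setT (fun x => (g x)^-1%R).
Proof.
move=> mg g0; rewrite (_ : (fun x => _) = fun x => (g x `^ (-1))%R).
  exact: (measurableT_comp (measurable_powR (-1)%R) mg).
by apply/funext => x; rewrite powR_inv1.
Qed.

Lemma measurable_ratio (f g : T -> R) : measurable_fun setT f ->
  measurable_fun setT g -> (forall x, (0 <= g x)%R) ->
  measurable_fun setT (fun x => f x / g x)%R.
Proof. by move=> mf mg g0; apply: measurable_funM => //; exact: measurable_invr_ge0. Qed.

End measurable_ratio.

(** * Convex sets of densities and their common exponent *)

Section convex_sets_of_densities.
Context (dY : measure_display) (Y : measurableType dY) (R : realType).
Variable mu : {sigma_finite_measure set Y -> \bar R}.

Lemma density_mixture (t : R) (f g : Y -> R) : in01 t ->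
  density mu f -> density mu g -> density mu (fun y => t * f y + (1 - t) * g y)%R.
Proof.
move=> /andP[t0 t1] [mf f0 f1] [mg g0 g1]; split.
- by apply: measurable_funD; exact: measurable_funM.
- by move=> y; rewrite addr_ge0// mulr_ge0// subr_ge0.
- under eq_integral do rewrite EFinD !EFinM.
  have mEf : measurable_fun setT (EFin \o f) by exact/measurable_EFinP.
  have mEg : measurable_fun setT (EFin \o g) by exact/measurable_EFinP.
  rewrite ge0_integralD//.
  + rewrite !ge0_integralZl_EFin ?subr_ge0//.
    * by rewrite f1 g1 !mule1 -EFinD addrC subrK.
    * by move=> y _; rewrite lee_fin.
    * by move=> y _; rewrite lee_fin.
  + by move=> y _; rewrite mule_ge0// lee_fin.
  + exact: measurable_funeM.
  + by move=> y _; rewrite mule_ge0// lee_fin// subr_ge0.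
  + exact: measurable_funeM.
Qed.

Let discrete_measurable (X : set (g_sigma_algebraType [set: set (Y -> R)])) :
  measurable X.
Proof. exact: sub_sigma_algebra. Qed.

(* A two-point mixture is an integral with respect to the image of a Bernoulli
   law, on the sigma-algebra of all sets of functions. *)
Lemma convex_densities2 (A : set (Y -> R)) (t : R) (f g : Y -> R) : in01 t ->
  convex_densities mu A -> A f -> A g -> A (fun y => t * f y + (1 - t) * g y)%R.
Proof.
move=> t01 [Ad Aconv] Af Ag.
pose X (b : bool) : g_sigma_algebraType [set: set (Y -> R)] := if b then f else g.
have mX : measurable_fun setT X by [].
pose X' : {mfun bool >-> g_sigma_algebraType [set: set (Y -> R)]} :=
  HB.pack X (isMeasurableFun.Build _ _ _ _ X mX).
pose G : set (Y -> R) := [set f] `|` [set g].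
have XG : X @^-1` G = setT by apply/seteqP; split=> // -[] _; [left|right].
apply: (Aconv _ (distribution (bernoulli_prob t) X') G).
- by move=> _ [->|->].
- split; first exact: discrete_measurable.
  move=> _ B mB.
  rewrite (_ : _ `&` _ = ((f @^-1` B) `*` [set f]) `|` ((g @^-1` B) `*` [set g])).
    have [mf _ _] := Ad _ Af; have [mg _ _] := Ad _ Ag.
    apply: measurableU; apply: measurableX; try exact: discrete_measurable.
      by rewrite -[X in measurable X]setTI; exact: mf.
    by rewrite -[X in measurable X]setTI; exact: mg.
  apply/seteqP; split=> [[y h] [[_ /= [->|->]] By]|[y h] [[/= By ->]|[/= By ->]]].
  + by left.
  + by right.
  + by split => //; split => //; left.
  + by split => //; split => //; right.
- by rewrite /distribution /pushforward/= XG probability_setT.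
- by apply: density_mixture => //; exact: Ad.
- apply: aeW => y; have [_ f0 _] := Ad _ Af; have [_ g0 _] := Ad _ Ag.
  rewrite ge0_integral_pushforward//.
  + rewrite XG integral_bernoulli_prob//=.
      by move=> [] /=; rewrite lee_fin.
  + by move=> h; rewrite inE => -[->|->]; rewrite lee_fin.
Qed.

Variables (f0 fstar : Y -> R) (Q : probability Y R).
Hypotheses (df0 : density mu f0) (dfstar : density mu fstar).
Hypothesis QE : forall B, measurable B -> Q B = \int[mu]_(y in B) (f0 y)%:E.

Lemma integral_lawE (g : Y -> \bar R) : measurable_fun setT g ->
  (forall y, 0 <= g y) -> \int[Q]_y g y = \int[mu]_y (g y * (f0 y)%:E).
Proof.
have [mf0 f00 _] := df0; apply: ge0_integral_density => //.
exact/measurable_EFinP.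
Qed.

Lemma hstarE (a : R) (f : Y -> R) : density mu f -> a != 0%R ->
  hstar mu f0 fstar a f = hpow Q (fun y => f y / fstar y)%R a.
Proof.
move=> [mf fge0 _] a0; have [ms s0 _] := dfstar.
rewrite /hstar (negbTE a0) /hpow integral_lawE.
- by apply: eq_integral => y _; rewrite EFinM pow0_powR.
- by apply: measurable_pow0_comp; exact: measurable_ratio.
- by move=> y; rewrite lee_fin pow0_ge0.
Qed.

Lemma minimax_densities (A : set (Y -> R)) (c0 c : R) : (0 < c0)%R -> (c0 < c)%R ->
  (c <= 1)%R -> convex_densities mu A ->
  (forall f, A f ->
    ereal_inf [set hstar mu f0 fstar a f | a in `[0%R, 1%R]] < c0%:E) ->
  exists2 a, in01 a & forall f, A f -> hpow Q (fun y => f y / fstar y)%R a <= c%:E.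
Proof.
move=> c00 c0c c1 Aconv Asmall; have [Ad _] := Aconv.
have [ms s0 _] := dfstar.
have mr f : A f -> measurable_fun setT (fun y => f y / fstar y)%R.
  by move=> Af; apply: measurable_ratio => //; have [] := Ad _ Af.
have r0 f y : A f -> (0 <= f y / fstar y)%R.
  by move=> Af; rewrite divr_ge0//; have [] := Ad _ Af.
apply: (@minimax_family _ _ A (fun f => hpow Q (fun y => f y / fstar y)%R) c0 c) => //.
- by move=> f a _; exact: hpow_ge0.
- move=> f t a b Af t01 _ _.
  by apply: hpow_convex => //; [exact: mr|move=> y; exact: r0].
- move=> f a b Af /andP[a0 _] _ ab.
  by apply: hpow_fin => //; [exact: mr|move=> y; exact: r0].
- move=> f u a Af _ _ ua.
  by apply: hpow_lsc => //; [exact: mr|move=> y; exact: r0].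
- move=> f g t Af Ag t01; exists (fun y => t * f y + (1 - t) * g y)%R.
    exact: convex_densities2.
  move=> a a01.
  rewrite [leRHS](_ : _ = hpow Q
      (fun y => t * (f y / fstar y) + (1 - t) * (g y / fstar y))%R a).
    apply: hpow_concave => //; try exact: mr; by move=> y; exact: r0.
  by congr (hpow Q _ a); apply/funext => y; rewrite mulrDl !mulrA.
- move=> f Af; have := Asmall _ Af; move=> /ereal_inf_lt[_ [a a01 <-] ha].
  (* [hstar] is 1 at exponent 0, above [c0], so the witness is an exponent where [hstar] and [hpow]
     agree. *)
  have a0 : a != 0%R.
    apply/eqP => a0; move: ha; rewrite a0 /hstar eqxx lte_fin; lra.
  exists a; first by move: a01; rewrite /= in_itv.
  by rewrite -hstarE//; exact: Ad.
Qed.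

End convex_sets_of_densities.

(** * Integrated likelihood ratios over a convex set *)

Section probability_with_density.
Context d (T : measurableType d) (R : realType).
Variables (mu : {measure set T -> \bar R}) (w : T -> \bar R).
Hypotheses (mw : measurable_fun setT w) (w0 : forall x, 0 <= w x).
Hypothesis w1 : \int[mu]_x w x = 1.

Let dens (A : set T) := \int[mu]_(x in A) w x.

Let dens0 : dens set0 = 0. Proof. by rewrite /dens integral_set0. Qed.

Let dens_ge0 A : 0 <= dens A. Proof. exact: integral_ge0. Qed.

Let dens_sigma_additive : semi_sigma_additive dens.
Proof.
move=> F mF tF mUF; rewrite /dens ge0_integral_bigcup//; last first.
  exact: measurable_funTS.
by apply: is_cvg_nneseries => n _ _; exact: dens_ge0.
Qed.

HB.instance Definition _ := isMeasure.Build _ _ _ dens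
  dens0 dens_ge0 dens_sigma_additive.

HB.instance Definition _ := Measure_isProbability.Build _ _ _ dens w1.

Lemma probability_with_density :
  exists nu : probability T R, forall A, nu A = \int[mu]_(x in A) w x.
Proof. by exists dens. Qed.

End probability_with_density.

Section likelihood.
Context (dY : measure_display) (Y : measurableType dY) (R : realType).
Context (S : set (set (Y -> R))).
Variables (fstar : Y -> R) (F0 : set (Y -> R)).
Local Notation FT := (g_sigma_algebraType S).

(* The value f y, made 0 for f outside F0 so as to be measurable in (y, f)
   on the whole product. *)
Definition eval0 (z : Y * FT) : R :=
  ((fun z : Y * FT => z.2 z.1) \_ ([set: Y] `*` (F0 : set FT))) z.

Definition ratio0 (z : Y * FT) : R := (eval0 z / fstar z.1)%R.

Definition lik0 n (z : seq_space Y * FT) : R :=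
  (\prod_(i < n) ratio0 (z.1 i, z.2))%R.

Lemma eval0E y f : F0 f -> eval0 (y, f) = f y.
Proof. by move=> Ff; rewrite /eval0 patchE mem_set. Qed.

Lemma eval0_out y f : ~ F0 f -> eval0 (y, f) = 0%R.
Proof. by move=> Ff; rewrite /eval0 patchE memNset//= => -[]. Qed.

Lemma lik0E n (x : seq_space Y) f : F0 f -> lik0 n (x, f) = lik_ratio fstar n x f.
Proof. by move=> Ff; apply: eq_bigr => i _; rewrite /ratio0 eval0E. Qed.

Lemma lik0S n (x : seq_space Y) f :
  lik0 n.+1 (x, f) = (ratio0 (x 0%N, f) * lik0 n (seq_shift x, f))%R.
Proof. by rewrite /lik0 big_ord_recl. Qed.

Variable mu : {sigma_finite_measure set Y -> \bar R}.
Hypotheses (dF0 : F0 `<=` density mu) (dfstar : density mu fstar).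
Hypothesis hS : jointly_measurable S F0.

Lemma measurable_eval0 : measurable_fun setT eval0.
Proof.
case: hS => mF0 mev; apply/(measurable_restrictT _ _).1 => //.
exact: measurableX.
Qed.

Lemma eval0_ge0 z : (0 <= eval0 z)%R.
Proof.
case: z => y f; have [Ff|Ff] := pselect (F0 f); last by rewrite eval0_out.
by rewrite eval0E//; have [_ f0 _] := dF0 Ff.
Qed.

Lemma ratio0_ge0 z : (0 <= ratio0 z)%R.
Proof. by have [_ s0 _] := dfstar; rewrite divr_ge0// eval0_ge0. Qed.

Lemma lik0_ge0 n z : (0 <= lik0 n z)%R.
Proof. by apply: prodr_ge0 => i _; exact: ratio0_ge0. Qed.

Lemma measurable_ratio0 : measurable_fun setT ratio0.
Proof.
have [ms s0 _] := dfstar; apply: measurable_ratio => //.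
  exact: measurable_eval0.
exact: (measurableT_comp ms measurable_fst).
Qed.

Lemma measurable_lik0 n : measurable_fun setT (lik0 n).
Proof.
apply: measurable_prod => i _.
apply: (measurableT_comp measurable_ratio0).
apply: measurable_fun_pair; last exact: measurable_snd.
exact: (measurableT_comp (measurable_coord i) measurable_fst).
Qed.

Variable Pi : probability FT R.

Lemma integral_lik0 (G : set FT) n (x : seq_space Y) : G `<=` F0 ->
  \int[Pi]_(f in G) (lik_ratio fstar n x f)%:E =
  \int[Pi]_(f in G) (lik0 n (x, f))%:E.
Proof. by move=> GF0; apply: eq_integral => f /set_mem/GF0 Ff; rewrite lik0E. Qed.

Lemma measurable_integral_lik (G : set FT) n : measurable G -> G `<=` F0 ->
  measurable_fun setT (fun x : seq_space Y =>
    \int[Pi]_(f in G) (lik_ratio fstar n x f)%:E).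
Proof.
move=> mG GF0; rewrite (_ : (fun x => _) = (fun x : seq_space Y =>
    \int[Pi]_f (\1_G f * lik0 n (x, f))%:E)); last first.
  apply/funext => x; rewrite integral_lik0// integral_mkcond.
  apply: eq_integral => f _; rewrite patchE indicE.
  by case: ifPn => _; rewrite ?mul1r ?mul0r.
apply: (measurable_fun_fubini_tonelli_F
  (fun t : seq_space Y * FT => (\1_G t.2 * lik0 n t)%:E)); last first.
  by move=> t; rewrite lee_fin mulr_ge0// lik0_ge0.
apply/measurable_EFinP; apply: measurable_funM; last exact: (measurable_lik0 n).
exact: (measurableT_comp (measurable_indic mG) measurable_snd).
Qed.

End likelihood.

Section extended_power.
Context (R : realType).

(** Integrated likelihood ratios can be infinite. Their power is then +oo, even at exponent 0, so
    that bounding the power controls these samples too. *)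
Definition epow0 (a : R) (z : \bar R) : \bar R :=
  if z \is a fin_num then (pow0 a (fine z))%:E else +oo.

Lemma epow0_ge0 a z : 0 <= epow0 a z.
Proof. by rewrite /epow0; case: ifP => // _; rewrite lee_fin pow0_ge0. Qed.

Lemma measurable_epow0 a : measurable_fun setT (epow0 a).
Proof.
apply: measurable_fun_ifT.
- apply: (measurable_fun_bool true).
  by rewrite (_ : _ @^-1` _ = [set z | id z \is a fin_num]);
    [exact: emeasurable_fin_num|].
- apply/measurable_EFinP; apply: (measurableT_comp (measurable_pow0 a)).
  exact: fine_measurable.
- exact: measurable_cst.
Qed.

End extended_power.

Section predictive.
Context (dY : measure_display) (Y : measurableType dY) (R : realType).
Context (S : set (set (Y -> R))).
Variables (mu : {sigma_finite_measure set Y -> \bar R}) (f0 fstar : Y -> R).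
Variables (Q : probability Y R) (PP : probability (seq_space Y) R).
Hypotheses (df0 : density mu f0) (dfstar : density mu fstar).
Hypothesis QE : forall B, measurable B -> Q B = \int[mu]_(y in B) (f0 y)%:E.
Hypothesis QPP : iid_law Q PP.
Variables (F0 : set (Y -> R)) (Pi : probability (g_sigma_algebraType S) R).
Hypotheses (dF0 : F0 `<=` density mu) (hS : jointly_measurable S F0).
Local Notation FT := (g_sigma_algebraType S).
Local Notation eval0 := (@eval0 _ Y R S F0).
Local Notation ratio0 := (@ratio0 _ Y R S fstar F0).
Local Notation lik0 := (@lik0 _ Y R S fstar F0).

Let meval := measurable_eval0 hS.
Let mratio := measurable_ratio0 dfstar hS.
Let eval_ge0 := @eval0_ge0 _ Y R S F0 mu dF0.
Let ratio_ge0 := @ratio0_ge0 _ Y R S fstar F0 mu dF0 dfstar.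
Let lik_ge0 := @lik0_ge0 _ Y R S fstar F0 mu dF0 dfstar.
Let mlik := measurable_lik0 dfstar hS.

Lemma law_ae (A : Y -> Prop) :
  {ae mu, forall y, A y} -> {ae Q, forall y, A y}.
Proof.
have [mf0 _ _] := df0.
move=> [N [mN N0 AN]]; exists N; split => //; rewrite QE// null_set_integral//.
by apply: measurable_funTS; exact/measurable_EFinP.
Qed.

(** Tonelli's theorem: every density that carries weight has total mass 1. *)
Lemma integral_eval0 (w : FT -> R) : measurable_fun setT w ->
  (forall f, (0 <= w f)%R) -> (forall f, ~ F0 f -> w f = 0%R) ->
  \int[mu]_y \int[Pi]_f (w f * eval0 (y, f))%:E = \int[Pi]_f (w f)%:E.
Proof.
move=> mw w0 wF.
have mF : measurable_fun setT (fun z : Y * FT => (w z.2 * eval0 z)%:E).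
  apply/measurable_EFinP; apply: measurable_funM => //.
  exact: (measurableT_comp mw measurable_snd).
rewrite [LHS](fubini_tonelli (fun z : Y * FT => (w z.2 * eval0 z)%:E))//=; last first.
  by move=> z; rewrite lee_fin mulr_ge0.
apply: eq_integral => f _ /=; have [Ff|Ff] := pselect (F0 f); last first.
  by rewrite wF//; under eq_integral do rewrite mul0r; rewrite integral0.
under eq_integral do rewrite EFinM.
rewrite ge0_integralZl_EFin//.
- under eq_integral do rewrite eval0E//.
  by have [_ _ ->] := dF0 Ff; rewrite mule1.
- by move=> y _; rewrite lee_fin.
- apply/measurable_EFinP.
  exact: (measurableT_comp meval (measurable_pair2 f)).
Qed.

Variables (B : set (Y -> R)) (a c : R).
Hypotheses (Bconv : convex_densities mu B) (a01 : in01 a) (c0 : (0 < c)%R).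
Hypothesis Bsmall : forall f, B f -> hpow Q (fun y => f y / fstar y)%R a <= c%:E.
Hypothesis mBF : measurable (B `&` F0 : set FT).

(** Such a weight stands for the indicator of [B] times the likelihood ratio of the observations
    already seen. *)
Let good_weight (w : FT -> R) := [/\ measurable_fun setT w,
  (forall f, (0 <= w f)%R) & (forall f, ~ (B `&` F0) f -> w f = 0%R)].

Let weight_ratio (w : FT -> R) y : good_weight w ->
  good_weight (fun f => w f * ratio0 (y, f))%R.
Proof.
move=> [mw w0 wB]; split.
- apply: measurable_funM => //.
  exact: (measurableT_comp mratio (measurable_pair1 y)).
- by move=> f; rewrite mulr_ge0.
- by move=> f /wB ->; rewrite mul0r.
Qed.

(* After normalization the integrals of w f * f y are the values of a mixture
   of elements of B, hence of a member of B. *)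
Lemma predictive_step (w : FT -> R) : good_weight w ->
  \int[Q]_y epow0 a (\int[Pi]_f (w f * ratio0 (y, f))%:E) <=
  c%:E * epow0 a (\int[Pi]_f (w f)%:E).
Proof.
move=> [mw w0 wB]; have [ms s0 _] := dfstar; have [mf0 f00 _] := df0.
have mEw : measurable_fun setT (EFin \o w) by exact/measurable_EFinP.
have [wfin|winf] := boolP (\int[Pi]_f (w f)%:E \is a fin_num); last first.
  by rewrite /epow0 (negbTE winf) gt0_muley ?leey// lte_fin.
set m := fine (\int[Pi]_f (w f)%:E).
have mE : \int[Pi]_f (w f)%:E = m%:E by rewrite fineK.
have m0 : (0 <= m)%R by rewrite -lee_fin -mE integral_ge0// => f _; rewrite lee_fin.
have epm : epow0 a m%:E = (pow0 a m)%:E by [].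
have wF f : ~ F0 f -> w f = 0%R by move=> Ff; apply: wB => -[].
pose J y := \int[Pi]_f (w f * eval0 (y, f))%:E.
have mJ2 : measurable_fun setT (fun z : Y * FT => (w z.2 * eval0 z)%:E).
  apply/measurable_EFinP; apply: measurable_funM => //.
  exact: (measurableT_comp mw measurable_snd).
have J0 y : 0 <= J y.
  by apply: integral_ge0 => f _; rewrite lee_fin mulr_ge0.
have mJ : measurable_fun setT J.
  apply: (measurable_fun_fubini_tonelli_F _ mJ2) => z.
  by rewrite lee_fin mulr_ge0.
have Jint : \int[mu]_y J y = m%:E by rewrite integral_eval0.
have Jfin : {ae mu, forall y, J y \is a fin_num}.
  have : mu.-integrable setT J.
    apply/integrableP; split => //.
    under eq_integral do rewrite gee0_abs//.
    by rewrite Jint ltry.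
  by move=> /(integrable_ae measurableT); apply: filterS => y; exact.
have ratioJ y : \int[Pi]_f (w f * ratio0 (y, f))%:E = J y * ((fstar y)^-1)%:E.
  rewrite /J -ge0_integralZr//.
  - by apply: eq_integral => f _; rewrite -EFinM mulrA.
  - apply/measurable_EFinP; apply: measurable_funM => //.
    exact: (measurableT_comp meval (measurable_pair1 y)).
  - by move=> f _; rewrite lee_fin mulr_ge0.
  - by rewrite lee_fin invr_ge0.
rewrite mE epm; under eq_integral do rewrite ratioJ.
have mint : measurable_fun setT (fun y => epow0 a (J y * ((fstar y)^-1)%:E)).
  apply: (measurableT_comp (measurable_epow0 a)).
  apply: emeasurable_funM => //; apply/measurable_EFinP.
  exact: measurable_invr_ge0.
(* A zero mass cannot be normalized, but then [J] vanishes almost everywhere, and [pow0 a 0 = 0]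
   settles the case at every exponent. *)
have [m00|mN0] := eqVneq m 0%R.
  rewrite (ge0_ae_eq_integral (g := cst 0))//.
  - by rewrite integral0 mule_ge0// lee_fin ?pow0_ge0// ltW.
  - by move=> y _; exact: epow0_ge0.
  - apply: law_ae; have : ae_eq mu setT J (cst 0).
      apply/(ae_eq_integral_abs _ measurableT mJ).
      by under eq_integral do rewrite gee0_abs//; rewrite Jint m00.
    apply: filterS => y /(_ I) -> _.
    by rewrite mul0e /epow0/= pow00.
have mgt : (0 < m)%R by rewrite lt_neqAle eq_sym mN0.
pose wd f := (w f / m)%:E.
have mwd : measurable_fun setT wd.
  by apply/measurable_EFinP; exact: measurable_funM.
have wd0 f : 0 <= wd f by rewrite lee_fin divr_ge0.
have wd1 : \int[Pi]_f wd f = 1.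
  under eq_integral do rewrite /wd EFinM.
  rewrite ge0_integralZr//.
  - by rewrite mE -EFinM divff.
  - by move=> f _; rewrite lee_fin.
  - by rewrite lee_fin invr_ge0.
have [nu nuE] := probability_with_density mwd wd0 wd1.
pose G : set FT := B `&` F0.
have nuG : nu G = 1.
  rewrite nuE -wd1 integral_mkcond; apply: eq_integral => f _.
  rewrite patchE; case: ifPn => // /negP fG; rewrite /wd wB ?mul0r//.
  by move=> /mem_set.
have mixE y : \int[nu]_(f in G) (f y)%:E = (m^-1)%:E * J y.
  rewrite integral_mkcond.
  rewrite (eq_integral (fun f => (\1_G f * eval0 (y, f))%:E)); last first.
    move=> f _; rewrite patchE indicE; case: ifPn => [/set_mem[_ Ff]|_].
      by rewrite eval0E// mul1r.
    by rewrite mul0r.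
  rewrite (ge0_integral_density mwd wd0 (fun A _ => nuE A)); last 2 first.
  - apply/measurable_EFinP; apply: measurable_funM.
      exact: measurable_indic.
    exact: (measurableT_comp meval (measurable_pair1 y)).
  - by move=> f; rewrite lee_fin mulr_ge0.
  rewrite /J -ge0_integralZl_EFin ?invr_ge0//.
  - apply: eq_integral => f _; rewrite /wd -!EFinM; congr EFin.
    rewrite indicE; have [fG|fG] := boolP (f \in G).
      by rewrite mul1r; move: (m^-1)%R => i; ring.
    by rewrite wB ?mul0r ?mulr0// => /mem_set; exact/negP.
  - by move=> f _; rewrite lee_fin mulr_ge0.
  - apply/measurable_EFinP; apply: measurable_funM => //.
    exact: (measurableT_comp meval (measurable_pair1 y)).
(* [J] may be infinite on a null set; [h] is a finite version of the mixture, and convexity puts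
   every version in [B]. *)
pose h y := fine ((m^-1)%:E * J y).
have mmJ : measurable_fun setT (fun y => (m^-1)%:E * J y).
  exact: measurable_funeM.
have hE : {ae mu, forall y, (h y)%:E = (m^-1)%:E * J y}.
  by move: Jfin; apply: filterS => y Jy; rewrite /h fineK// fin_numM.
have h0 y : (0 <= h y)%R by rewrite fine_ge0// mule_ge0// lee_fin invr_ge0.
have mh : measurable_fun setT h by exact: (measurableT_comp (fine_measurable measurableT) mmJ).
have hd : density mu h.
  split => //.
  rewrite (ge0_ae_eq_integral (g := fun y => (m^-1)%:E * J y))//.
  - by rewrite ge0_integralZl_EFin ?invr_ge0// Jint -EFinM mulVf.
  - exact/measurable_EFinP.
  - by move=> y _; rewrite lee_fin.
  - by move=> y _; rewrite mule_ge0// lee_fin invr_ge0.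
  - by move: hE; apply: filterS => y + _.
have Bh : B h.
  have [_ Bc] := Bconv; apply: (Bc S nu G) => //.
  - by move=> f [].
  - split; first exact: mBF.
    case: hS => mF0 mev; apply: (measurable_funS _ _ mev).
      exact: measurableX.
    by move=> [y f] [_ [_ Ff]].
  - by move: hE; apply: filterS => y ->; rewrite mixE.
have mr : measurable_fun setT (fun y => h y / fstar y)%R by exact: measurable_ratio.
rewrite (ge0_ae_eq_integral (g := fun y => (pow0 a m)%:E * (pow0 a (h y / fstar y))%:E))//.
- rewrite ge0_integralZl_EFin ?pow0_ge0//.
  + by rewrite muleC lee_wpmul2r ?lee_fin ?pow0_ge0//; exact: Bsmall.
  + by move=> y _; rewrite lee_fin pow0_ge0.
  + exact: measurable_pow0_comp.
- by apply: measurable_funeM; exact: measurable_pow0_comp.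
- by move=> y _; exact: epow0_ge0.
- by move=> y _; rewrite mule_ge0// lee_fin pow0_ge0.
- apply: law_ae; move: hE Jfin; apply: filterS2 => y hy Jy _.
  have -> : J y = (m * h y)%:E.
    by rewrite EFinM hy muleA -EFinM divff// mul1e.
  rewrite -EFinM /epow0/= -EFinM -pow0M// ?divr_ge0//.
  by rewrite mulrA.
Qed.

(** Peeling off the first observation [y] replaces [w] by [w * ratio0 (y, _)], again a good weight.
    The induction hypothesis treats the later observations, then [predictive_step] integrates over
    [y]. *)
Lemma predictive_bound n (w : FT -> R) : good_weight w ->
  \int[PP]_x epow0 a (\int[Pi]_f (w f * lik0 n (x, f))%:E) <=
  (c ^+ n)%:E * epow0 a (\int[Pi]_f (w f)%:E).
Proof.
elim: n w => [|n IH] w gw; have [mw w0 wB] := gw.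
  rewrite expr0 mul1e.
  rewrite (eq_integral (cst (epow0 a (\int[Pi]_f (w f)%:E)))); last first.
    move=> x _; congr (epow0 a _); apply: eq_integral => f _.
    by rewrite /lik0 big_ord0 mulr1.
  by rewrite integral_probability_cst.
pose W (z : Y * seq_space Y) : \bar R :=
  \int[Pi]_f (w f * ratio0 (z.1, f) * lik0 n (z.2, f))%:E.
have mW : measurable_fun setT W.
  apply: (measurable_fun_fubini_tonelli_F
    (fun t : (Y * seq_space Y) * FT =>
      (w t.2 * ratio0 (t.1.1, t.2) * lik0 n (t.1.2, t.2))%:E)); last first.
    by move=> t; rewrite lee_fin; do 2?apply: mulr_ge0.
  apply/measurable_EFinP; apply: measurable_funM; first apply: measurable_funM.
  - exact: (measurableT_comp mw measurable_snd).
  - apply: (measurableT_comp mratio); apply: measurable_fun_pair => //.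
    exact: (measurableT_comp measurable_fst measurable_fst).
  - apply: (measurableT_comp (mlik n)); apply: measurable_fun_pair => //.
    exact: (measurableT_comp measurable_snd measurable_fst).
have meW : measurable_fun setT (epow0 a \o W).
  exact: (measurableT_comp (measurable_epow0 a) mW).
rewrite (eq_integral (fun x : seq_space Y => (epow0 a \o W) (x 0%N, seq_shift x))); last first.
  move=> x _; rewrite /= /W/=; congr (epow0 a _); apply: eq_integral => f _.
  by rewrite lik0S mulrA.
rewrite (iid_law_peel QPP meW); last by move=> z; exact: epow0_ge0.
apply: (@le_trans _ _ (\int[Q]_y ((c ^+ n)%:E *
    epow0 a (\int[Pi]_f (w f * ratio0 (y, f))%:E)))).
  have mw2 : measurable_fun setT (fun y => \int[Pi]_f (w f * ratio0 (y, f))%:E).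
    apply: (measurable_fun_fubini_tonelli_F
      (fun t : Y * FT => (w t.2 * ratio0 t)%:E)); last first.
      by move=> t; rewrite lee_fin mulr_ge0.
    apply/measurable_EFinP; apply: measurable_funM => //.
    exact: (measurableT_comp mw measurable_snd).
  have mF : measurable_fun setT (fubini_F PP (epow0 a \o W)).
    by apply: measurable_fun_fubini_tonelli_F => // z; exact: epow0_ge0.
  apply: ge0_le_integral => //.
  - by move=> y _; apply: integral_ge0 => x _; exact: epow0_ge0.
  - apply: measurable_funeM.
    exact: (measurableT_comp (measurable_epow0 a) mw2).
  - move=> y _; exact: (IH _ (@weight_ratio w y gw)).
have mw2 : measurable_fun setT (fun y => epow0 a (\int[Pi]_f (w f * ratio0 (y, f))%:E)).
  apply: (measurableT_comp (measurable_epow0 a)).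
  apply: (measurable_fun_fubini_tonelli_F
    (fun t : Y * FT => (w t.2 * ratio0 t)%:E)); last first.
    by move=> t; rewrite lee_fin mulr_ge0.
  apply/measurable_EFinP; apply: measurable_funM => //.
  exact: (measurableT_comp mw measurable_snd).
rewrite ge0_integralZl_EFin//; last 2 first.
- by move=> y _; exact: epow0_ge0.
- by rewrite exprn_ge0// ltW.
rewrite exprSr EFinM -muleA lee_wpmul2l ?lee_fin ?exprn_ge0 ?(ltW c0)//.
exact: predictive_step.
Qed.

(** Markov's inequality for the [a]-th power. As [a <= 1] and [s >= 0], a ratio above
    [exp (- n * s)] has its power above the same threshold, and the initial prior mass contributes
    at most 1. *)
Lemma predictive_tail n (s : R) : (0 <= s)%R ->
  PP [set x | (expR (- (n%:R * s)))%:E <=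
              \int[Pi]_(f in B `&` F0) (lik_ratio fstar n x f)%:E] <=
  ((c * expR s) ^+ n)%:E.
Proof.
move=> s0; pose w : FT -> R := \1_(B `&` F0 : set FT).
have gw : good_weight w.
  split; first exact: measurable_indic.
  - by move=> f; rewrite /w indicE.
  - by move=> f fB; rewrite /w indicE memNset.
have [mw w0 _] := gw.
pose L (x : seq_space Y) := \int[Pi]_f (w f * lik0 n (x, f))%:E.
have LE (x : seq_space Y) :
    \int[Pi]_(f in B `&` F0) (lik_ratio fstar n x f)%:E = L x.
  rewrite integral_mkcond; apply: eq_integral => f _.
  rewrite patchE /w indicE; case: ifPn => [/set_mem[_ Ff]|_].
    by rewrite mul1r lik0E.
  by rewrite mul0r.
have mL : measurable_fun setT L.
  rewrite (_ : L = fun x => \int[Pi]_(f in B `&` F0) (lik_ratio fstar n x f)%:E).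
    by apply: (measurable_integral_lik dF0 dfstar hS) => // f [].
  by apply/funext => x; rewrite LE.
set t := expR _.
have -> : [set x | t%:E <= \int[Pi]_(f in B `&` F0) (lik_ratio fstar n x f)%:E] =
    [set x | t%:E <= L x] by apply/seteqP; split=> x /=; rewrite LE.
have t0 : (0 < t)%R by exact: expR_gt0.
have mE : measurable [set x | t%:E <= L x].
  by rewrite -[X in measurable X]setTI; exact: emeasurable_fun_c_infty.
have meL : measurable_fun setT (fun x => epow0 a (L x)).
  exact: (measurableT_comp (measurable_epow0 a) mL).
have := markov_ge PP meL (fun x => epow0_ge0 a (L x)) (ltW t0).
move=> /le_trans /(_ (predictive_bound n gw)) h.
have w1 : \int[Pi]_f (w f)%:E = Pi (B `&` F0 : set FT).
  by rewrite integral_indic// setIT.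
have ew : epow0 a (\int[Pi]_f (w f)%:E) <= 1.
  have Pfin : Pi (B `&` F0 : set FT) \is a fin_num by exact: fin_num_measure.
  rewrite w1 /epow0 Pfin lee_fin.
  have P1 : (fine (Pi (B `&` F0 : set FT)) <= 1)%R.
    by rewrite -lee_fin fineK// probability_le1.
  have P0 : (0 <= fine (Pi (B `&` F0 : set FT)))%R by rewrite fine_ge0.
  apply: (le_trans (pow0_le_affine a01 P0)); case/andP: a01 => a0 a1.
  by have : (0 <= a * (1 - fine (Pi (B `&` F0 : set FT))))%R;
    [rewrite mulr_ge0 ?subr_ge0|lra].
have cn0 : (0 <= c ^+ n)%R by rewrite exprn_ge0// ltW.
have {}h : t%:E * PP [set x | t%:E <= L x] <= (c ^+ n)%:E.
  apply: (@le_trans _ _ (t%:E * PP [set x | t%:E <= epow0 a (L x)])).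
    rewrite lee_pmul2l//; apply: le_measure; rewrite ?inE//.
      by rewrite -[X in measurable X]setTI; exact: emeasurable_fun_c_infty.
    move=> x /=; rewrite /epow0; have [Lf|_] := boolP (_ \is a fin_num);
      last by rewrite leey.
    rewrite -{1}(fineK Lf) !lee_fin => tL; apply: pow0_ge_expRN => //.
    by rewrite mulr_ge0.
  by apply: (le_trans h); rewrite -[leRHS]mule1 lee_wpmul2l.
rewrite exprMn -expRM_natl -[X in expR X]opprK expRN -/t.
have -> : ((c ^+ n * t^-1)%:E = (t^-1)%:E * (c ^+ n)%:E) by rewrite -EFinM mulrC.
by rewrite -(@lee_pmul2l _ t%:E)// -!EFinM mulrA divff ?gt_eqF// mul1r.
Qed.

End predictive.

(** * Kullback-Leibler divergence and the evidence *)

Section kullback_leibler_integrand.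
Context (R : realType).

Definition klterm (u v : R) : \bar R := u%:E * lne (u%:E / v%:E).

Lemma klterm0 v : klterm 0 v = 0.
Proof. by rewrite /klterm mul0e. Qed.

Lemma klterm_inf u : (0 < u)%R -> klterm u 0 = +oo.
Proof.
move=> u0; rewrite /klterm /inve eqxx gt0_muley ?lte_fin//=.
by rewrite gt0_muley ?lte_fin.
Qed.

Lemma klterm_gt0 u v : (0 < u)%R -> (0 < v)%R ->
  klterm u v = (u * ln (u / v))%:E.
Proof.
move=> u0 v0; rewrite /klterm /inve gt_eqF// -EFinM lne_EFin ?divr_gt0//.
Qed.

(** This is [ln x <= x - 1] at [v / u]. It makes the divergence nonnegative and bounds the negative
    part of its integrand by the second density. *)
Lemma klterm_ge u v : (0 <= u)%R -> (0 <= v)%R -> (u - v)%:E <= klterm u v.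
Proof.
rewrite le_eqVlt => /predU1P[<- v0|u0]; first by rewrite klterm0 lee_fin; lra.
rewrite le_eqVlt => /predU1P[<-|v0]; first by rewrite klterm_inf// leey.
rewrite klterm_gt0// lee_fin.
have uv : (0 < u / v)%R by rewrite divr_gt0.
have := expR_ge1Dx (- ln (u / v)); rewrite expRN lnK ?posrE// invf_div => h.
have : (u * (1 - ln (u / v)) <= u * (v / u))%R by rewrite ler_pM2l.
have -> : (u * (v / u) = v)%R by rewrite mulrC divfK ?gt_eqF.
move=> ?; lra.
Qed.

Lemma measurable_klterm d (T : measurableType d) (g h : T -> R) :
  measurable_fun setT g -> measurable_fun setT h ->
  (forall x, (0 <= g x)%R) -> (forall x, (0 <= h x)%R) ->
  measurable_fun setT (fun x => klterm (g x) (h x)).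
Proof.
move=> mg mh g0 h0.
rewrite (_ : (fun x => _) = fun x => if (g x == 0%R) then 0 else
    if (h x == 0%R) then +oo else (g x * ln (g x / h x))%:E); last first.
  apply/funext => x; have [->|gx] := eqVneq (g x) 0%R; first exact: klterm0.
  have gx0 : (0 < g x)%R by rewrite lt_neqAle eq_sym gx g0.
  have [->|hx] := eqVneq (h x) 0%R; first exact: klterm_inf.
  by rewrite klterm_gt0// lt_neqAle eq_sym hx h0.
apply: measurable_fun_ifT; [exact: measurable_fun_eqr|exact: measurable_cst|].
apply: measurable_fun_ifT; [exact: measurable_fun_eqr|exact: measurable_cst|].
apply/measurable_EFinP; apply: measurable_funM => //.
apply: (measurableT_comp (@measurable_ln R)); exact: measurable_ratio.
Qed.

End kullback_leibler_integrand.

Section kullback_leibler.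
Context (dY : measure_display) (Y : measurableType dY) (R : realType).
Variables (mu : {sigma_finite_measure set Y -> \bar R}) (f0 : Y -> R).
Variables (Q : probability Y R) (PP : probability (seq_space Y) R).
Hypotheses (df0 : density mu f0).
Hypothesis QE : forall B, measurable B -> Q B = \int[mu]_(y in B) (f0 y)%:E.
Hypothesis QPP : iid_law Q PP.

Let mf0 : measurable_fun setT f0. Proof. by have [] := df0. Qed.
Let f00 y : (0 <= f0 y)%R. Proof. by have [_ ->] := df0. Qed.

Lemma integral_law_signed (g : Y -> R) : measurable_fun setT g ->
  \int[Q]_y (g y)%:E = \int[mu]_y (g y * f0 y)%:E.
Proof.
move=> mg; have mEg : measurable_fun setT (EFin \o g) by exact/measurable_EFinP.
rewrite integralE [RHS]integralE; congr (_ - _).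
- rewrite (integral_lawE df0 QE)//; last exact: measurable_funepos.
  apply: eq_integral => y _; rewrite !funeposE -!EFin_max -EFinM.
  by rewrite maxr_pMl// mul0r.
- rewrite (integral_lawE df0 QE)//; last exact: measurable_funeneg.
  apply: eq_integral => y _; rewrite !funenegE -!EFinN -!EFin_max -EFinM.
  by rewrite maxr_pMl// mul0r mulNr.
Qed.

Section finite_divergence.
Variable f : Y -> R.
Hypotheses (df : density mu f) (KLfin : KL mu f0 f < +oo).

Let mf : measurable_fun setT f. Proof. by have [] := df. Qed.
Let f_ge0 y : (0 <= f y)%R. Proof. by have [_ ->] := df. Qed.

Lemma density_integrable (g : Y -> R) : density mu g -> mu.-integrable setT (EFin \o g).
Proof.
move=> [mg g0 g1]; apply/integrableP; split; first exact/measurable_EFinP.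
rewrite (eq_integral (EFin \o g)); first by rewrite g1 ltry.
by move=> y _; rewrite /= ger0_norm.
Qed.

Let mkl : measurable_fun setT (fun y => klterm (f0 y) (f y)).
Proof. exact: measurable_klterm. Qed.

Lemma KL_integrable : mu.-integrable setT (fun y => klterm (f0 y) (f y)).
Proof.
have neg : \int[mu]_y ((fun y => klterm (f0 y) (f y))^\- y) < +oo.
  apply: (@le_lt_trans _ _ (\int[mu]_y (f y)%:E)).
    apply: ge0_le_integral => //.
    - exact: measurable_funeneg.
    - exact/measurable_EFinP.
    - move=> y _; rewrite funenegE ge_max lee_fin f_ge0 andbT leeNl -EFinN.
      by apply: le_trans (klterm_ge _ _) => //; rewrite lee_fin; have := f00 y; lra.
  by have [_ _ ->] := df; rewrite ltry.
have pos : \int[mu]_y ((fun y => klterm (f0 y) (f y))^\+ y) < +oo.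
  move: KLfin; rewrite /KL integralE => h; rewrite ltNge leye_eq; apply/negP => /eqP p.
  move: h; rewrite p addye//.
  by rewrite eqe_oppLR; move: neg; rewrite ltey => nI; exact: nI.
apply/integrableP; split => //.
rewrite (eq_integral (fun y => (fun y => klterm (f0 y) (f y))^\+ y +
  (fun y => klterm (f0 y) (f y))^\- y)); last first.
  by move=> y _; rewrite -[LHS]/((abse \o (fun y => klterm (f0 y) (f y))) y) fune_abse.
rewrite ge0_integralD//; last 2 first.
- exact: measurable_funepos.
- exact: measurable_funeneg.
exact: lte_add_pinfty.
Qed.

Lemma KL_ge0 : 0 <= KL mu f0 f.
Proof.
have ifg := integrableB measurableT (density_integrable df0) (density_integrable df).
have : \int[mu]_y ((f0 y)%:E - (f y)%:E) <= KL mu f0 f.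
  apply: le_integral => //; first exact: KL_integrable.
  by move=> y _; rewrite -EFinB klterm_ge.
rewrite integralB//; [|exact: density_integrable|exact: density_integrable].
by have [_ _ ->] := df0; have [_ _ ->] := df; rewrite subee.
Qed.

(** The integrand is infinite where [f = 0 < f0], so finite divergence makes that set null. *)
Lemma KL_ae_gt0 : {ae Q, forall y, (0 < f0 y)%R /\ (0 < f y)%R}.
Proof.
have A0 : {ae Q, forall y, (0 < f0 y)%R}.
  exists [set y | (f0 y <= 0)%R]; split.
  - rewrite (_ : [set y | _] = ~` [set y | (0 < f0 y)%R]).
      by apply: measurableC; exact: measurable_gtr.
    by apply/seteqP; split=> y /=; rewrite leNgt => /negP.
  - have mA : measurable [set y | (f0 y <= 0)%R].
      rewrite (_ : [set y | _] = ~` [set y | (0 < f0 y)%R]).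
        by apply: measurableC; exact: measurable_gtr.
      by apply/seteqP; split=> y /=; rewrite leNgt => /negP.
    rewrite QE//; apply: integral0_eq => y /= fy; congr EFin.
    by apply/eqP; rewrite eq_le fy f00.
  - by move=> y /= /negP; rewrite -leNgt.
have A1 : {ae Q, forall y, klterm (f0 y) (f y) \is a fin_num}.
  apply: (law_ae df0 QE); have := integrable_ae measurableT KL_integrable.
  by apply: filterS => y; exact.
move: A0 A1; apply: filterS2 => y fy kl; split => //.
rewrite lt_neqAle eq_sym f_ge0 andbT; apply/eqP => fy0.
by move: kl; rewrite fy0 klterm_inf.
Qed.

Let z y := ln (f0 y / f y).

Let mz : measurable_fun setT z.
Proof. apply: (measurableT_comp (@measurable_ln R)); exact: measurable_ratio. Qed.

Let z_klterm : {ae mu, forall y, (z y * f0 y)%:E = klterm (f0 y) (f y)}.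
Proof.
have := integrable_ae measurableT KL_integrable.
apply: filterS => y /(_ I) kl.
have [f0y|f0y] := eqVneq (f0 y) 0%R; first by rewrite f0y klterm0 mulr0.
have f0gt : (0 < f0 y)%R by rewrite lt_neqAle eq_sym f0y f00.
have [fy|fy] := eqVneq (f y) 0%R; first by move: kl; rewrite fy klterm_inf.
by rewrite klterm_gt0 1?mulrC// lt_neqAle eq_sym fy f_ge0.
Qed.

Lemma integral_log_ratio : \int[Q]_y (ln (f0 y / f y))%:E = KL mu f0 f.
Proof.
rewrite integral_law_signed//; apply: ae_eq_integral => //.
- by apply/measurable_EFinP; exact: measurable_funM.
- by move: z_klterm; apply: filterS => y + _.
Qed.

Lemma integrable_log_ratio : Q.-integrable setT (fun y => (ln (f0 y / f y))%:E).
Proof.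
apply/integrableP; split; first exact/measurable_EFinP.
have /integrableP[_] := KL_integrable; apply: le_lt_trans.
rewrite (integral_lawE df0 QE)//; last first.
  by apply/measurable_EFinP; exact: measurableT_comp.
rewrite le_eqVlt; apply/orP; left; apply/eqP.
apply: ge0_ae_eq_integral => //.
- apply: emeasurable_funM; last exact/measurable_EFinP.
  by apply/measurable_EFinP; exact: measurableT_comp.
- exact: measurableT_comp.
- by move=> y _; rewrite mule_ge0// lee_fin.
- move: z_klterm; apply: filterS => y <- _ /=.
  by rewrite -EFinM normrM (ger0_norm (f00 y)).
Qed.

End finite_divergence.

Lemma lik_ratio_expR (g h : Y -> R) n (x : seq_space Y) :
  (forall i, 0 < g (x i) /\ 0 < h (x i))%R ->
  lik_ratio h n x g = expR (\sum_(i < n) ln (g (x i) / h (x i))).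
Proof.
move=> gh; rewrite expR_sum; apply: eq_bigr => i _; have [g0 h0] := gh i.
by rewrite lnK// posrE divr_gt0.
Qed.

Variable fstar : Y -> R.
Hypotheses (dfstar : density mu fstar) (KLstar_fin : KL mu f0 fstar < +oo).

(** The law of large numbers is applied to [ln (f0 / f) - ln (f0 / fstar)]: both terms are
    integrable, with the two divergences as means. Positivity of the three densities at the
    observations turns the difference into [ln (fstar / f)]. *)
Lemma lik_ratio_lower f (e : R) : density mu f -> KLstar mu f0 fstar f < e%:E ->
  {ae PP, forall x : seq_space Y, \forall n \near \oo,
    (expR (- (n%:R * e)) <= lik_ratio fstar n x f)%R}.
Proof.
move=> df Ke; have K0 := KL_ge0 dfstar KLstar_fin.
have Ksf : KL mu f0 fstar \is a fin_num by rewrite ge0_fin_numE.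
have KLfin : KL mu f0 f < +oo.
  rewrite ltNge leye_eq; apply/negP => /eqP h; move: Ke; rewrite /KLstar h.
  by rewrite addye// -(fineK Ksf).
have i1 := integrable_log_ratio df KLfin.
have i2 := integrable_log_ratio dfstar KLstar_fin.
pose z y := (ln (f0 y / f y) - ln (f0 y / fstar y))%R.
have [mf fge0 _] := df; have [ms sge0 _] := dfstar.
have mz : measurable_fun setT z.
  by apply: measurable_funB; apply: (measurableT_comp (@measurable_ln R));
    exact: measurable_ratio.
have iz : Q.-integrable setT (EFin \o z).
  have := integrableB measurableT i1 i2.
  by apply: eq_integrable => // y _; rewrite /= EFinB.
have zc : \int[Q]_y (z y)%:E < e%:E.
  under eq_integral do rewrite EFinB.
  by rewrite integralB// integral_log_ratio// integral_log_ratio.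
have := lln_upper QPP mz iz zc.
have /ae_foralln := fun i => iid_law_ae QPP i (KL_ae_gt0 df KLfin).
have /ae_foralln := fun i => iid_law_ae QPP i (KL_ae_gt0 dfstar KLstar_fin).
apply: filterS3 => x px1 px2; apply: filterS => n zn.
rewrite lik_ratio_expR; last first.
  by move=> i; have [_ ?] := px1 i; have [_ ?] := px2 i.
rewrite ler_expR lerNl -sumrN mulrC; apply: le_trans zn.
rewrite le_eqVlt; apply/orP; left; apply/eqP; apply: eq_bigr => i _.
have [a1 a2] := px1 i; have [b1 b2] := px2 i.
by rewrite /z !ln_div ?posrE//; ring.
Qed.

Lemma lik_ratio_upper (e : R) : KL mu f0 fstar < e%:E ->
  {ae PP, forall x : seq_space Y, \forall n \near \oo,
    (lik_ratio fstar n x f0 <= expR (n%:R * e))%R}.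
Proof.
move=> Ke; have [ms sge0 _] := dfstar.
pose z y := ln (f0 y / fstar y).
have mz : measurable_fun setT z.
  by apply: (measurableT_comp (@measurable_ln R)); exact: measurable_ratio.
have zc : \int[Q]_y (z y)%:E < e%:E by rewrite integral_log_ratio.
have := lln_upper QPP mz (integrable_log_ratio dfstar KLstar_fin) zc.
have /ae_foralln := fun i => iid_law_ae QPP i (KL_ae_gt0 dfstar KLstar_fin).
apply: filterS2 => x px; apply: filterS => n zn.
by rewrite lik_ratio_expR// ler_expR mulrC.
Qed.

Section prior.
Context (S : set (set (Y -> R))).
Variables (F0 : set (Y -> R)) (Pi : probability (g_sigma_algebraType S) R).
Hypotheses (dF0 : F0 `<=` density mu) (hS : jointly_measurable S F0).
Local Notation FT := (g_sigma_algebraType S).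

(** Tonelli's theorem makes the integrals of the positive and of the negative part of the integrand
    measurable in [f]. *)
Lemma measurable_KLball (e : R) :
  measurable ([set f : FT | KLstar mu f0 fstar f < e%:E] `&` F0).
Proof.
pose kl (z : Y * FT) := klterm (f0 z.1) (eval0 F0 z).
have mkl : measurable_fun setT kl.
  apply: measurable_klterm.
  - exact: (measurableT_comp mf0 measurable_fst).
  - exact: measurable_eval0.
  - by move=> z; exact: f00.
  - by move=> z; exact: (eval0_ge0 dF0).
pose p (f : FT) := \int[mu]_y (kl^\+ (y, f)).
pose q (f : FT) := \int[mu]_y (kl^\- (y, f)).
have mp : measurable_fun setT p.
  by apply: (measurable_fun_fubini_tonelli_G kl^\+) => //; exact: measurable_funepos.
have mq : measurable_fun setT q.
  by apply: (measurable_fun_fubini_tonelli_G kl^\-) => //; exact: measurable_funeneg.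
have [mF0 _] := hS.
have mpq : measurable_fun setT (fun f => p f - q f - KL mu f0 fstar).
  by apply: emeasurable_funB => //; exact: emeasurable_funB.
rewrite (_ : _ `&` _ = [set f : FT | p f - q f - KL mu f0 fstar < e%:E] `&` F0).
  apply: measurableI => //; rewrite -[X in measurable X]setTI.
  exact: emeasurable_fun_infty_o.
have pqE f : F0 f -> p f - q f = KL mu f0 f.
  move=> Ff; rewrite /KL [RHS]integralE /p /q.
  by congr (_ - _); apply: eq_integral => y _; rewrite ?funeposE ?funenegE /kl/= eval0E.
by apply/seteqP; split=> f /= [h Ff]; split=> //; move: h; rewrite /KLstar pqE.
Qed.

Lemma evidence_lower (e : R) :
  0 < Pi ([set f : FT | KLstar mu f0 fstar f < e%:E] `&` F0) ->
  {ae PP, forall x : seq_space Y, exists2 C : R, (0 < C)%R &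
    \forall n \near \oo, (C * expR (- (n%:R * e)))%:E <=
      \int[Pi]_(f in F0) (lik_ratio fstar n x f)%:E}.
Proof.
set G : set FT := _ `&` _ => PG; have mG : measurable G := measurable_KLball e.
have [mF0 _] := hS.
have mlik := measurable_lik0 dfstar hS.
have lik_ge0 := lik0_ge0 dF0 dfstar.
pose A n := [set z : seq_space Y * FT | (expR (- (n%:R * e)) <= lik0 fstar F0 n z)%R].
have mA n : measurable (A n) by exact: measurable_ger.
pose E := \bigcup_N \bigcap_(n in [set n | (N <= n)%N]) A n.
have mE : measurable E.
  by apply: bigcup_measurable => N _; apply: bigcap_measurableType => n _.
(* The pairs at which the lower bound fails infinitely often. Its sections at a fixed density are
   null, hence so are its sections at almost every sample. *)
pose H : set (seq_space Y * FT) := (setT `*` G) `\` E.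
have mH : measurable H by apply: measurableD => //; exact: measurableX.
have mH1 : measurable_fun setT (fun z => (\1_H z : R)%:E).
  by apply/measurable_EFinP; exact: measurable_indic.
have H0 z : 0 <= (\1_H z : R)%:E by rewrite lee_fin.
have sec f : \int[PP]_x (\1_H (x, f) : R)%:E = 0.
  have [[Kf Ff]|Gf] := pselect (G f); last first.
    under eq_integral.
      move=> x _; rewrite indicE memNset; last by move=> [[_ /= ?] _].
      over.
    by rewrite integral0.
  rewrite (ge0_ae_eq_integral (g := cst 0))//; first by rewrite integral0.
    exact: (measurableT_comp mH1 (measurable_pair2 f)).
  have := lik_ratio_lower (dF0 Ff) Kf; apply: filterS => x [N _ hN] _ /=.
  rewrite indicE memNset// => -[_]; apply; exists N => // n /= Nn.
  by rewrite /A/= lik0E//; exact: hN.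
have : \int[PP]_x \int[Pi]_f (\1_H (x, f) : R)%:E = 0.
  rewrite (fubini_tonelli (fun z => (\1_H z : R)%:E))//=.
  by under eq_integral do rewrite sec; rewrite integral0.
pose h x := \int[Pi]_f (\1_H (x, f) : R)%:E.
have mh : measurable_fun setT h.
  exact: (measurable_fun_fubini_tonelli_F _ mH1).
have h0 x : 0 <= h x by apply: integral_ge0.
move=> ih; have : ae_eq PP setT h (cst 0).
  apply/(ae_eq_integral_abs _ measurableT mh).
  by rewrite -[RHS]ih; apply: eq_integral => x _; rewrite gee0_abs.
apply: filterS => x /(_ I) hx.
pose D N : set FT := G `&` \bigcap_(n in [set n | (N <= n)%N]) [set f | A n (x, f)].
have mAx n : measurable [set f : FT | A n (x, f)].
  apply: measurable_ger.
  exact: (measurableT_comp (mlik n) (measurable_pair1 x)).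
have mD N : measurable (D N).
  by apply: measurableI => //; apply: bigcap_measurableType => n _.
(* Up to a null set [G] is the union of the [D N], so one of them has positive mass; this mass is
   the constant [C], which depends on the sample. *)
have [N PDN] : exists N, 0 < Pi (D N).
  apply: contrapT => nD.
  have D0 N : Pi (D N) = 0.
    apply/eqP; rewrite eq_le measure_ge0 andbT leNgt; apply/negP => ?.
    by apply: nD; exists N.
  have mUD : measurable (\bigcup_N D N) by exact: bigcup_measurable.
  have UD0 : Pi (\bigcup_N D N) = 0.
    apply/eqP; rewrite eq_le measure_ge0 andbT.
    apply: (le_trans (measure_sigma_subadditive Pi mD mUD (fun f => id))).
    by rewrite eseries0// => N _ _; exact: D0.
  pose Hx := [set f : FT | H (x, f)].
  have mHx : measurable Hx.
    rewrite (_ : Hx = xsection H x); first exact: measurable_xsection.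
    by apply/seteqP; split=> f; rewrite /xsection/= inE.
  have Hx0 : Pi Hx = 0.
    rewrite -[RHS]hx /h -[in LHS](setIT Hx) -integral_indic//.
  have : Pi G <= Pi (\bigcup_N D N `|` Hx).
    apply: le_measure; rewrite ?inE//; first exact: measurableU.
    move=> f Gf; have [Ef|Ef] := pselect (E (x, f)); last by right; split.
    by left; case: Ef => N _ EN; exists N => //; split => // n /= Nn; exact: EN.
  rewrite leNgt => /negP; apply; apply: le_lt_trans PG.
  apply: (le_trans (measureU2 _ mUD mHx)).
  by rewrite [X in X + _]UD0 [X in _ + X]Hx0 adde0.
have Pfin : Pi (D N) \is a fin_num by exact: fin_num_measure.
exists (fine (Pi (D N))); first by rewrite -lte_fin fineK.
exists N => // n /= Nn.
have -> : \int[Pi]_(f in F0) (lik_ratio fstar n x f)%:E =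
    \int[Pi]_(f in F0) (lik0 fstar F0 n (x, f))%:E.
  by apply: eq_integral => f /set_mem Ff; rewrite lik0E.
have mlx : measurable_fun setT (fun f : FT => (lik0 fstar F0 n (x, f))%:E).
  apply/measurable_EFinP.
  exact: (measurableT_comp (mlik n) (measurable_pair1 x)).
apply: (@le_trans _ _ (\int[Pi]_(f in D N) (lik0 fstar F0 n (x, f))%:E)); last first.
  apply: ge0_subset_integral => //.
  - exact: measurable_funTS.
  - by move=> f _; rewrite lee_fin.
  - by move=> f [[]].
apply: (@le_trans _ _ (\int[Pi]_(f in D N) (expR (- (n%:R * e)))%:E)).
  by rewrite integral_cst// mulrC EFinM fineK.
apply: ge0_le_integral => //.
- exact: measurable_funTS.
- by move=> f [_ Df]; rewrite lee_fin; exact: (Df n Nn).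
Qed.

(** The mean of [f / f0] under [f0] is at most 1, so by Tonelli the integrated ratio has mean at
    most the prior mass. Markov's inequality at level [exp (- n * t)] leaves the geometric ratio
    [exp (t - Delta)]. *)
Lemma small_prior_lik (W : nat -> set (Y -> R)) (Delta t : R) :
  (forall n, (1 <= n)%N -> measurable (W n `&` F0 : set FT)) -> (t < Delta)%R ->
  (forall n, (1 <= n)%N -> Pi (W n `&` F0 : set FT) < (expR (- (n%:R * Delta)))%:E) ->
  {ae PP, forall x : seq_space Y, \forall n \near \oo,
    \int[Pi]_(f in W n `&` F0) (lik_ratio f0 n x f)%:E < (expR (- (n%:R * t)))%:E}.
Proof.
move=> mW tD PW; have [mF0 _] := hS.
have mlik := measurable_lik0 df0 hS.
have lik_ge0 := lik0_ge0 dF0 df0.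
(* The hypotheses on [W] start at 1; the weight 0 at [n = 0] is measurable as well. *)
pose w n (f : FT) : R := if n is 0 then 0%R else \1_(W n `&` F0 : set FT) f.
have mw n : measurable_fun setT (w n).
  by case: n => [|n]; [exact: measurable_cst|apply: measurable_indic; exact: mW].
have w0 n f : (0 <= w n f)%R by case: n.
pose M n (x : seq_space Y) := \int[Pi]_f (w n f * lik0 f0 F0 n (x, f))%:E.
have mwl n : measurable_fun setT
    (fun z : seq_space Y * FT => (w n z.2 * lik0 f0 F0 n z)%:E).
  apply/measurable_EFinP; apply: measurable_funM => //.
  exact: (measurableT_comp (mw n) measurable_snd).
have mM n : measurable_fun setT (M n).
  apply: (measurable_fun_fubini_tonelli_F _ (mwl n)) => z.
  by rewrite lee_fin mulr_ge0.
have M0 n x : 0 <= M n x.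
  by apply: integral_ge0 => f _; rewrite lee_fin mulr_ge0.
have ratio_le1 f : F0 f -> \int[Q]_y (f y / f0 y)%:E <= 1.
  move=> Ff; have [mf fge0 f1] := dF0 Ff.
  rewrite (integral_lawE df0 QE).
  - rewrite -f1; apply: ge0_le_integral => //.
    + by move=> y _; rewrite -EFinM lee_fin mulr_ge0// divr_ge0.
    + apply: emeasurable_funM; last exact/measurable_EFinP.
      by apply/measurable_EFinP; exact: measurable_ratio.
    + exact/measurable_EFinP.
    (* The mass of [f] where [f0] vanishes is lost, whence an inequality. *)
    + move=> y _; rewrite -EFinM lee_fin; have [->|f0y] := eqVneq (f0 y) 0%R.
        by rewrite mulr0.
      by rewrite divfK.
  - by apply/measurable_EFinP; exact: measurable_ratio.
  - by move=> y; rewrite lee_fin divr_ge0.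
have EM n : (1 <= n)%N -> \int[PP]_x M n x <= Pi (W n `&` F0 : set FT).
  move=> n1; rewrite /M (fubini_tonelli
      (fun z : seq_space Y * FT => (w n z.2 * lik0 f0 F0 n z)%:E))//=; last first.
    by move=> z; rewrite lee_fin mulr_ge0.
  have -> : Pi (W n `&` F0 : set FT) = \int[Pi]_f (w n f)%:E.
    by case: n n1 => // n _; rewrite /w integral_indic ?setIT//; exact: mW.
  apply: ge0_le_integral => //.
  - by move=> f _; apply: integral_ge0 => x _; rewrite lee_fin mulr_ge0.
  - apply: (measurable_fun_fubini_tonelli_G _ (mwl n)) => z.
    by rewrite lee_fin mulr_ge0.
  - exact/measurable_EFinP.
  - move=> f _; under eq_integral do rewrite EFinM.
    rewrite ge0_integralZl_EFin//; last 2 first.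
    + by move=> x _; rewrite lee_fin.
    + apply/measurable_EFinP.
      exact: (measurableT_comp (mlik n) (measurable_pair2 f)).
    have [Ff|Ff] := pselect (F0 f); last first.
      have -> : w n f = 0%R.
        by case: n n1 => // n _; rewrite /w indicE memNset// => -[].
      by rewrite mul0e.
    rewrite -[leRHS]mule1 lee_wpmul2l ?lee_fin//.
    under eq_integral do rewrite lik0E//.
    have [mf fge0 _] := dF0 Ff.
    rewrite (iid_law_prod QPP n (g := fun y => (f y / f0 y)%R)).
    + have := ratio_le1 _ Ff.
      have r0 : 0 <= \int[Q]_y (f y / f0 y)%:E.
        by apply: integral_ge0 => y _; rewrite lee_fin divr_ge0.
      move=> r1; elim: (n) => [|k IH]; first by rewrite expe0.
      by rewrite expeS -[leRHS]mule1; apply: lee_pmul => //; exact: expe_ge0.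
    + exact: measurable_ratio.
    + by move=> y; rewrite divr_ge0.
pose A n := [set x : seq_space Y | (expR (- (n%:R * t)))%:E <= M n x].
have mA n : measurable (A n).
  by rewrite -[A n]setTI; exact: emeasurable_fun_c_infty.
have := @borel_cantelli_geometric _ _ R PP A (expR (t - Delta)) mA (expR_ge0 _).
case.
- by rewrite -expR0 ltr_expR subr_lt0.
- exists 1%N => // n /= n1.
  have := markov_ge PP (mM n) (M0 n) (expR_ge0 (- (n%:R * t))).
  move=> /le_trans /(_ (EM n n1)) /le_lt_trans /(_ (PW n n1)) /ltW h.
  rewrite -expRM_natl mulrBr expRD.
  rewrite -(@lee_pmul2l _ (expR (- (n%:R * t)))%:E) ?lte_fin ?expR_gt0//.
  apply: (le_trans h); rewrite -EFinM lee_fin mulrA -expRD.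
  by rewrite addNr expR0 mul1r.
- move=> N [mN N0 NA]; exists N; split => //; apply: subset_trans NA => x /= nx ax.
  apply: nx; have n1 : \forall n \near \oo, (1 <= n)%N by exists 1%N.
  move: ax n1; apply: filterS2 => n nA n1.
  rewrite ltNge; apply/negP => h; apply: nA; rewrite /A/=.
  apply: (le_trans h); rewrite integral_mkcond /M le_eqVlt; apply/orP; left.
  apply/eqP; apply: eq_integral => f _; case: n n1 h => // n _ _.
  rewrite patchE /w indicE; case: ifPn => [/set_mem[_ Ff]|_].
    by rewrite mul1r lik0E.
  by rewrite mul0r.
Qed.

End prior.
End kullback_leibler.

(** * Unions and polynomial growth *)

Section integral_over_unions.
Context d (T : measurableType d) (R : realType) (mu : {measure set T -> \bar R}).
Variable f : T -> \bar R.
Hypotheses (mf : measurable_fun setT f) (f_ge0 : forall x, 0 <= f x).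

Lemma ge0_integral_setU_le (A B : set T) : measurable A -> measurable B ->
  \int[mu]_(x in A `|` B) f x <= \int[mu]_(x in A) f x + \int[mu]_(x in B) f x.
Proof.
move=> mA mB; have -> : A `|` B = A `|` (B `\` A).
  apply/seteqP; split=> x; last by case=> [|[]]; [left|right].
  by case=> [|Bx]; [left|have [Ax|Ax] := pselect (A x); [left|right]].
rewrite ge0_integral_setU//.
- rewrite leeD2l//; apply: ge0_subset_integral => //; first exact: measurableD.
  exact: measurable_funTS.
- exact: measurableD.
- exact: measurable_funTS.
- by apply/disj_setPS => x [Ax []].
Qed.

Lemma ge0_integral_bigsetU_le (F : (set T)^nat) n : (forall k, measurable (F k)) ->
  \int[mu]_(x in \big[setU/set0]_(k < n) F k) f x <=
  \sum_(k < n) \int[mu]_(x in F k) f x.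
Proof.
move=> mF; elim: n => [|n IH]; first by rewrite !big_ord0 integral_set0.
rewrite !big_ord_recr/=; apply: (le_trans (ge0_integral_setU_le _ _)) => //.
  exact: bigsetU_measurable.
by rewrite leeD2r.
Qed.

End integral_over_unions.

Lemma polynomial_le_expR (R : realType) (a r s : R) : (0 < s)%R ->
  \forall n \near \oo, (a * n%:R `^ r <= expR (n%:R * s))%R.
Proof.
move=> s0; pose k := Num.bound `|r|.
have rk : (r <= k%:R)%R by apply: (le_trans (ler_norm r)); exact/ltW/archi_boundP/normr_ge0.
(* With [r <= k], one term of degree [k.+1] of the exponential series suffices: from [n >= b] on,
   its additional factor [n] absorbs [a] and the factorial. *)
pose b := (`|a| * (k.+1)`!%:R / s ^+ k.+1)%R.
near=> n.
have n1 : (1 <= n%:R :> R)%R by rewrite ler1n; near: n; exists 1%N.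
have bn : (b <= n%:R)%R by near: n; exact: nbhs_infty_ger.
have ns0 : (0 <= n%:R * s)%R by rewrite mulr_ge0// ltW.
have := expR_ge1Dxn k ns0.
have n0 : (0 <= n%:R ^+ k :> R)%R by rewrite exprn_ge0.
have h1 : (a * n%:R `^ r <= `|a| * n%:R ^+ k)%R.
  apply: (@le_trans _ _ (`|a| * n%:R `^ r)%R).
    by rewrite ler_wpM2r ?powR_ge0// ler_norm.
  by rewrite ler_wpM2l// -powR_mulrn// ler_powR.
have sk : (0 < s ^+ k.+1)%R by rewrite exprn_gt0.
have fk : (0 < (k.+1)`!%:R :> R)%R by rewrite ltr0n fact_gt0.
have h2 : (`|a| * n%:R ^+ k <= (n%:R * s) ^+ k.+1 / (k.+1)`!%:R)%R.
  rewrite ler_pdivlMr// exprMn exprSr.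
  have : (`|a| * (k.+1)`!%:R <= n%:R * s ^+ k.+1)%R by rewrite -ler_pdivrMr.
  move=> /(ler_wpM2l n0); rewrite mulrCA mulrA => h.
  by rewrite -[leRHS]mulrA.
move=> h3; apply: (le_trans h1); apply: (le_trans h2); apply: le_trans h3.
by rewrite lerDr.
Unshelve. all: by end_near. Qed.

(** * From the sample to the sequence space *)

Section sample_law.
Context (dY : measure_display) (Y : measurableType dY) (R : realType).
Variables (mu : {sigma_finite_measure set Y -> \bar R}) (f0 : Y -> R).
Context (dO : measure_display) (Omega : measurableType dO).
Variables (P : probability Omega R) (X : nat -> {RV P >-> Y}).
Hypothesis hX : iid_density mu X f0.

(** [PP] is the image of [P] under the whole sample, so null sets pull back; independence along
    [0, ..., k - 1] gives its values on cylinders. *)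
Lemma exists_sample_law : exists (Q : probability Y R)
    (PP : probability (seq_space Y) R),
  [/\ forall B, measurable B -> Q B = \int[mu]_(y in B) (f0 y)%:E,
      iid_law Q PP &
      forall A : seq_space Y -> Prop, {ae PP, forall x, A x} ->
        {ae P, forall w, A (fun i => X i w)}].
Proof.
case: hX => hlaw hind.
pose Xs (w : Omega) : seq_space Y := fun i => X i w.
have mXs : measurable_fun setT Xs by apply: measurable_to_seq_space => i.
pose Xs' : {mfun Omega >-> seq_space Y} :=
  HB.pack Xs (isMeasurableFun.Build _ _ _ _ Xs mXs).
exists (distribution P (X 0%N)), (distribution P Xs'); split.
- by move=> B mB; exact: hlaw.
- move=> k B mB.
  transitivity (P (\bigcap_(i in [set` iota 0 k]) (X i @^-1` B i))).
    congr (P _); apply/seteqP; split=> w h i /=.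
      by rewrite mem_iota add0n => ik; exact: h.
    by move=> ik; apply: (h i); rewrite /= mem_iota.
  rewrite hind ?iota_uniq// -[X in iota 0 X]subn0 -/(index_iota 0 k) big_mkord.
  by apply: eq_bigr => i _; rewrite hlaw//; apply/esym; exact: hlaw.
- move=> A [N [mN N0 AN]]; exists (Xs @^-1` N); split => //.
  + by have := mXs measurableT _ mN; rewrite setTI.
  + by move=> w /= nA; exact: AN.
Qed.

End sample_law.

Section covering.
Context (dY : measure_display) (Y : measurableType dY) (R : realType).
Variable mu : {sigma_finite_measure set Y -> \bar R}.

(** No mixing measure gives mass 1 to the empty set. The empty set pads finite covers to
    sequences. *)
Lemma convex_densities0 : convex_densities mu set0.
Proof.
split=> // S nu G h G0 _ nuG; have GE : G = set0 by apply/seteqP; split.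
by move: nuG; rewrite GE measure0 => /esym/eqP; rewrite onee_eq0.
Qed.

End covering.

(** * Asymptotics of the posterior *)

Lemma ratio_geometric_cvg0 (R : realType) (u v : nat -> \bar R) (M C e : R) :
  (0 < C)%R -> (0 < e)%R -> (forall n, 0 <= u n) -> (forall n, 0 <= v n) ->
  (\forall n \near \oo, u n <= (M * expR (- (n%:R * (2 * e))))%:E) ->
  (\forall n \near \oo, (C * expR (- (n%:R * e)))%:E <= v n) ->
  u n / v n @[n --> \oo] --> 0.
Proof.
move=> C0 e0 u0 v0 uM vC.
have q1 : (`|expR (- e)| < 1)%R by rewrite ger0_norm ?expR_ge0// expR_lt1 oppr_lt0.
have lim : (geometric (M / C) (expR (- e)) n)%:E @[n --> \oo] --> 0.
  by apply: cvg_EFin; [exact: nearW|exact: cvg_geometric].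
apply: (squeeze_cvge _ _ lim); last exact: cvg_cst.
near=> n; apply/andP; split.
  by rewrite mule_ge0// inve_ge0.
have Cn : (0 < C * expR (- (n%:R * e)))%R by rewrite mulr_gt0 ?expR_gt0.
have vn : (C * expR (- (n%:R * e)))%:E <= v n by near: n.
have un : u n <= (M * expR (- (n%:R * (2 * e))))%:E by near: n.
apply: (@le_trans _ _ (u n * ((C * expR (- (n%:R * e)))^-1)%:E)).
  (* The denominator may be +oo; its inverse is then 0. *)
  rewrite lee_wpmul2l//; case: (v n) vn => [r| |]//.
  - rewrite lee_fin => Cr; rewrite /inve gt_eqF ?(lt_le_trans Cn)//.
    by rewrite lee_fin lef_pV2 ?posrE// (lt_le_trans Cn).
  - by move=> _; rewrite lee_fin invr_ge0 ltW.
apply: (le_trans (lee_wpmul2r _ un)); first by rewrite lee_fin invr_ge0 ltW.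
rewrite -EFinM lee_fin /geometric/= -expRM_natl.
rewrite invfM -expRN opprK mulrACA -expRD.
by rewrite (_ : - (n%:R * (2 * e)) + n%:R * e = n%:R * - e)%R//; ring.
Unshelve. all: by end_near. Qed.

Lemma lik_ratio_ge0 (dY : measure_display) (Y : measurableType dY) (R : realType)
    (mu : {sigma_finite_measure set Y -> \bar R}) (g f : Y -> R) n (x : nat -> Y) :
  density mu g -> density mu f -> (0 <= lik_ratio g n x f)%R.
Proof. by move=> [_ g0 _] [_ f0 _]; apply: prodr_ge0 => i _; rewrite divr_ge0. Qed.

(** * The numerator of the posterior *)

Section posterior_numerator.
Context (dY : measure_display) (Y : measurableType dY) (R : realType).
Context (S : set (set (Y -> R))).
Variables (mu : {sigma_finite_measure set Y -> \bar R}) (f0 fstar : Y -> R).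
Variables (Q : probability Y R) (PP : probability (seq_space Y) R).
Hypotheses (df0 : density mu f0) (dfstar : density mu fstar).
Hypothesis QE : forall B, measurable B -> Q B = \int[mu]_(y in B) (f0 y)%:E.
Hypothesis QPP : iid_law Q PP.
Variables (F0 : set (Y -> R)) (Pi : probability (g_sigma_algebraType S) R).
Hypotheses (dF0 : F0 `<=` density mu) (hS : jointly_measurable S F0).
Local Notation FT := (g_sigma_algebraType S).

Let mlik := measurable_lik0 dfstar hS.
Let lik_ge0 := @lik0_ge0 _ Y R S fstar F0 mu dF0 dfstar.
Let likE := @integral_lik0 _ Y R S fstar F0 Pi.

(** The exponent budget: [3 * s] drops to [2 * s] in the minimax step, and to [s] when Markov's
    inequality is used at [exp (- n * s)]. The number of sets is eventually at most
    [exp (n * s / 2)], which leaves [s / 2] both for the probability of the union and for the sum of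
    the integrals. *)
Lemma cover_lik_small (s a r : R) (B : nat -> nat -> set (Y -> R))
    (J : nat -> nat) : (0 < s)%R ->
  (forall n k, convex_densities mu (B n k)) ->
  (forall n k, measurable (B n k `&` F0 : set FT)) ->
  (forall n k f, B n k f -> ereal_inf [set hstar mu f0 fstar alpha f |
     alpha in `[0%R, 1%R]] < (expR (- (3 * s)))%:E) ->
  (forall n, (1 <= n)%N -> ((J n)%:R <= a * n%:R `^ r)%R) ->
  {ae PP, forall x : seq_space Y, \forall n \near \oo,
    \int[Pi]_(f in \big[setU/set0]_(k < J n) (B n k `&` F0 : set FT))
      (lik_ratio fstar n x f)%:E <= (expR (- (n%:R * (s / 2))))%:E}.
Proof.
move=> s0 Bconv mB Bsmall Jle.
pose L n k (x : seq_space Y) :=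
  \int[Pi]_(f in B n k `&` F0) (lik_ratio fstar n x f)%:E.
pose E n k := [set x | (expR (- (n%:R * s)))%:E <= L n k x].
have mL n k : measurable_fun setT (L n k).
  by apply: (measurable_integral_lik dF0 dfstar hS) => // f [].
have mE n k : measurable (E n k).
  by rewrite -[E n k]setTI; exact: emeasurable_fun_c_infty.
have s20 : (0 < s / 2)%R by rewrite divr_gt0.
have PE n k : PP (E n k) <= ((expR (- s)) ^+ n)%:E.
  have [||||b b01 Bb] := @minimax_densities _ _ _ mu f0 fstar Q df0 dfstar QE
    (B n k) (expR (- (3 * s))) (expR (- (2 * s))) _ _ _ (Bconv n k).
  - exact: expR_gt0.
  - by rewrite ltr_expR; lra.
  - by rewrite -[leRHS]expR0 ler_expR; lra.
  - by move=> f; exact: Bsmall.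
  have := predictive_tail df0 dfstar QE QPP Pi dF0 hS (Bconv n k) b01
    (expR_gt0 _) Bb (mB n k) n (ltW s0).
  by rewrite -expRD (_ : - (2 * s) + s = - s)%R//; lra.
have Jexp : \forall n \near \oo, ((J n)%:R <= expR (n%:R * (s / 2)))%R.
  near=> n; apply: (@le_trans _ _ (a * n%:R `^ r)%R).
    by apply: Jle; near: n; exists 1%N.
  by near: n; exact: polynomial_le_expR.
have mA n : measurable (\big[setU/set0]_(k < J n) E n k).
  by apply: bigsetU_measurable => k _.
have := @borel_cantelli_geometric _ _ R PP
  (fun n => \big[setU/set0]_(k < J n) E n k) (expR (- (s / 2))) mA (expR_ge0 _).
rewrite expR_lt1 oppr_lt0 => /(_ s20) [].
  move: Jexp; apply: filterS => n Jn.
  apply: (le_trans (Boole_inequality PP (fun k _ => mE n k))).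
  apply: (@le_trans _ _ (\sum_(k < J n) ((expR (- s)) ^+ n)%:E)).
    by apply: lee_sum => k _; exact: PE.
  rewrite sumEFin sumr_const card_ord lee_fin -[leLHS]mulr_natl -!expRM_natl.
  apply: (le_trans (ler_wpM2r (expR_ge0 _) Jn)).
  by rewrite -expRD ler_expR; lra.
move=> N [mN N0 BN]; exists N; split => //; apply: subset_trans BN => x.
apply: contra_not => nE; move: Jexp nE; apply: filterS2 => n Jn nE.
rewrite likE; last first.
  apply: (big_ind (fun G : set FT => G `<=` F0)) => //.
  by move=> G G' GF GF' f [/GF|/GF'].
have mn : measurable_fun setT (fun f : FT => (lik0 fstar F0 n (x, f))%:E).
  apply/measurable_EFinP.
  exact: (measurableT_comp (mlik n) (measurable_pair1 x)).
have l0 (f : FT) : 0 <= (lik0 fstar F0 n (x, f))%:E by rewrite lee_fin lik_ge0.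
apply: (le_trans (ge0_integral_bigsetU_le Pi mn l0 (J n) (mB n))).
apply: (@le_trans _ _ (\sum_(k < J n) (expR (- (n%:R * s)))%:E)).
  apply: lee_sum => k _; rewrite -likE; last by move=> f [].
  apply/ltW; rewrite ltNge; apply/negP => Ek; apply: nE.
  by rewrite -(bigcup_mkord (J n) (E n)); exists k => //=.
rewrite sumEFin sumr_const card_ord lee_fin -[leLHS]mulr_natl.
apply: (le_trans (ler_wpM2r (expR_ge0 _) Jn)).
by rewrite -expRD ler_expR; lra.
Unshelve. all: by end_near. Qed.

Lemma prior_tail_lik_small (W : nat -> set (Y -> R)) (Delta t theta : R) :
  KL mu f0 fstar < +oo ->
  (forall n, (1 <= n)%N -> measurable (W n `&` F0 : set FT)) ->
  (forall n, (1 <= n)%N -> Pi (W n `&` F0 : set FT) < (expR (- (n%:R * Delta)))%:E) ->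
  KL mu f0 fstar < theta%:E -> (t < Delta)%R ->
  {ae PP, forall x : seq_space Y, \forall n \near \oo,
    \int[Pi]_(f in W n `&` F0) (lik_ratio fstar n x f)%:E <=
    (expR (- (n%:R * (t - theta))))%:E}.
Proof.
move=> Kfin mW PW Kt tD.
have h1 := small_prior_lik df0 QE QPP dF0 hS mW tD PW.
have h2 := lik_ratio_upper df0 QE QPP dfstar Kfin Kt.
have h3 : {ae PP, forall x : seq_space Y, forall i, (0 < f0 (x i))%R}.
  apply: ae_foralln => i; apply: (iid_law_ae QPP i (A := fun y => 0 < f0 y)%R).
  by have := KL_ae_gt0 df0 QE dfstar Kfin; apply: filterS => y [].
move: h1 h2 h3; apply: filterS3 => x x1 x2 x3.
have : \forall n \near \oo, (1 <= n)%N by exists 1%N.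
move: x1 x2; apply: filterS3 => n n1 n2 n0.
(* Changing the reference from [fstar] to [f0] is exact, because almost surely [f0] is positive at
   every observation. *)
have likM f : (lik_ratio fstar n x f)%:E =
    (lik_ratio fstar n x f0)%:E * (lik_ratio f0 n x f)%:E.
  rewrite -EFinM; congr EFin; rewrite /lik_ratio -big_split/=.
  apply: eq_bigr => i _; have := x3 i => fi.
  by rewrite [RHS]mulrC mulrA divfK ?gt_eqF.
under eq_integral do rewrite likM.
have l0 : (0 <= lik_ratio fstar n x f0)%R by exact: lik_ratio_ge0 dfstar df0.
have mn : measurable_fun setT (fun f : FT => (lik0 f0 F0 n (x, f))%:E).
  apply/measurable_EFinP.
  exact: (measurableT_comp (measurable_lik0 df0 hS n) (measurable_pair1 x)).
rewrite ge0_integralZl_EFin//; last 3 first.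
- exact: mW.
- by move=> f [_ Ff]; rewrite lee_fin; exact: lik_ratio_ge0 df0 (dF0 Ff).
- apply: (eq_measurable_fun (fun f : FT => (lik0 f0 F0 n (x, f))%:E)).
    by move=> f /set_mem[_ Ff]; rewrite lik0E.
  exact: measurable_funTS.
apply: (@le_trans _ _ ((expR (n%:R * theta))%:E * (expR (- (n%:R * t)))%:E)).
  apply: lee_pmul => //; last exact: ltW.
  apply: integral_ge0 => f [_ Ff]; rewrite lee_fin.
  exact: lik_ratio_ge0 df0 (dF0 Ff).
by rewrite -EFinM -expRD lee_fin ler_expR; lra.
Qed.

Lemma integral_lik_setU_le (G A B : set FT) n (x : seq_space Y) :
  measurable G -> measurable A -> measurable B -> A `<=` F0 -> B `<=` F0 ->
  G `<=` A `|` B ->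
  \int[Pi]_(f in G) (lik_ratio fstar n x f)%:E <=
  \int[Pi]_(f in A) (lik_ratio fstar n x f)%:E +
  \int[Pi]_(f in B) (lik_ratio fstar n x f)%:E.
Proof.
move=> mG mA mB AF BF GAB.
have mn : measurable_fun setT (fun f : FT => (lik0 fstar F0 n (x, f))%:E).
  apply/measurable_EFinP.
  exact: (measurableT_comp (mlik n) (measurable_pair1 x)).
have l0 (f : FT) : 0 <= (lik0 fstar F0 n (x, f))%:E by rewrite lee_fin lik_ge0.
rewrite !likE//; last by move=> f /GAB[/AF|/BF].
apply: (le_trans _ (ge0_integral_setU_le Pi mn l0 mA mB)).
apply: ge0_subset_integral => //; first exact: measurableU.
exact: measurable_funTS.
Qed.

End posterior_numerator.

(** * Covering the complement of a ball *)

Section metric_balls.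
Context (dY : measure_display) (Y : measurableType dY) (R : realType).
Context (S : set (set (Y -> R))).
Variable mu : {sigma_finite_measure set Y -> \bar R}.
Variables (F0 : set (Y -> R)) (d : (Y -> R) -> (Y -> R) -> R).
Local Notation FT := (g_sigma_algebraType S).
Local Notation H := (convex_hull mu F0).
Hypothesis hd : metric_on mu H d.
Hypothesis ball_convex : forall c (r : R), H c -> (0 < r)%R ->
  convex_densities mu (dball H d c r).
Hypothesis ball_meas : forall c (r : R), H c -> (0 < r)%R ->
  S.-sigma.-measurable (dball H d c r `&` F0).

Lemma sub_convex_hull : F0 `<=` H.
Proof. by move=> f Ff A [_ FA]; exact: FA. Qed.

(* Balls of radius < eps / 3 that meet the complement of the eps-ball around
   fstar are kept; they avoid its eps / 3-ball. *)
Lemma cover_outside_ball (fstar : Y -> R) (eps : R) (V : set (Y -> R)) (J : nat)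
    (c : 'I_J -> Y -> R) (rho : 'I_J -> R) : H fstar ->
  (forall j, [/\ H (c j), (0 < rho j)%R & (rho j < eps / 3)%R]) ->
  V `<=` [set f : Y -> R | exists j, dball H d (c j) (rho j) f] ->
  exists B : nat -> set (Y -> R),
    [/\ forall k, convex_densities mu (B k),
        forall k, measurable (B k `&` F0 : set FT),
        forall k f, B k f -> H f /\ ~ dball H d fstar (eps / 3) f
      & (V `&` ~` dball H d fstar eps) `&` F0 `<=`
        \big[setU/set0]_(k < J) (B k `&` F0)].
Proof.
move=> Hs cP VB; have [_ _ dC dT] := hd.
(* Indices from [J] on and balls inside the [eps]-ball all give the empty set. *)
pose B k := if insub k is Some j then
  if `[< dball H d (c j) (rho j) `&` ~` dball H d fstar eps !=set0 >]
  then dball H d (c j) (rho j) else set0 else set0.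
exists B; split.
- move=> k; rewrite /B; case: insubP => [j _ _|_]; last exact: convex_densities0.
  case: ifP => _; last exact: convex_densities0.
  by have [cj rj _] := cP j; exact: ball_convex.
- move=> k; rewrite /B; case: insubP => [j _ _|_]; last by rewrite set0I.
  case: ifP => _; last by rewrite set0I.
  by have [cj rj _] := cP j; exact: ball_meas.
- move=> k f; rewrite /B; case: insubP => [j _ _|_] //.
  case: asboolP => // -[g [[Hg dg] ng]] [Hf df]; split => // -[_ dfs]; apply: ng.
  split => //; have [cj _ rj] := cP j.
  (* From [g] to the center, to [f], to [fstar]: three distances below [eps / 3] would put [g] in
     the [eps]-ball. *)
  have := dT _ _ _ Hg cj Hs; have := dT _ _ _ cj Hf Hs; rewrite (dC (c j) f)//.
  by move=> h1 h2; lra.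
- move=> f [[Vf Uf] Ff]; rewrite -(bigcup_mkord J (fun k => B k `&` F0)).
  have [j Bj] := VB _ Vf; exists (nat_of_ord j) => //=; split => //.
  rewrite /B valK; case: asboolP => // h; case: h; by exists f.
Qed.

End metric_balls.

Theorem theorem3 (R : realType)
  (dY : measure_display) (Y : measurableType dY)
  (mu : {sigma_finite_measure set Y -> \bar R})
  (f0 : Y -> R) (F0 : set (Y -> R)) (fstar : Y -> R)
  (S : set (set (Y -> R))) (Pi : probability (g_sigma_algebraType S) R)
  (dO : measure_display) (Omega : measurableType dO)
  (P : probability Omega R) (X : nat -> {RV P >-> Y})
  (d : (Y -> R) -> (Y -> R) -> R)
  (hf0 : density mu f0)
  (hF0 : F0 `<=` density mu)
  (hX : iid_density mu X f0)
  (hS : jointly_measurable S F0)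
  (hPi : Pi F0 = 1)
  (hfstar : KL_minimizer mu F0 f0 fstar)
  (hint : forall f, F0 f -> \int[mu]_y ((f y / fstar y) * f0 y)%:E < +oo)
  (hint0 : \int[mu]_y (f0 y / fstar y)%:E < +oo)
  (hd : metric_on mu (convex_hull mu F0) d)
  (hball_convex : forall c (r : R), convex_hull mu F0 c -> (0 < r)%R ->
     convex_densities mu (dball (convex_hull mu F0) d c r))
  (hball_meas : forall c (r : R), convex_hull mu F0 c -> (0 < r)%R ->
     S.-sigma.-measurable (dball (convex_hull mu F0) d c r `&` F0))
  (h1 : forall eps : R, (0 < eps)%R ->
     0 < Pi ([set f : Y -> R | KLstar mu f0 fstar f < eps%:E] `&` F0))
  (h2 : forall eps : R, (0 < eps)%R -> exists2 delta : R, (0 < delta)%R &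
     [set f : Y -> R | convex_hull mu F0 f /\
        (expR (- delta))%:E <
        ereal_inf [set hstar mu f0 fstar alpha f | alpha in `[0%R, 1%R]]]
     `<=` dball (convex_hull mu F0) d fstar eps)
  (h3 : exists V W : nat -> set (Y -> R),
     [/\ forall n, (1 <= n)%N ->
           [/\ V n `<=` convex_hull mu F0, W n `<=` convex_hull mu F0,
               S.-sigma.-measurable (V n `&` F0),
               S.-sigma.-measurable (W n `&` F0)
             & F0 `<=` V n `|` W n],
         exists2 Delta : R, 2%:E * KL mu f0 fstar < Delta%:E &
           forall n, (1 <= n)%N ->
             Pi (W n `&` F0) < (expR (- (n%:R * Delta)))%:E
       & forall eps : R, (0 < eps)%R ->
           exists a r : R, [/\ (0 < a)%R, (0 < r)%R &
             forall n, (1 <= n)%N ->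
             exists (J : nat) (c : 'I_J -> Y -> R) (rho : 'I_J -> R),
               [/\ (J%:R <= a * n%:R `^ r)%R,
                   forall j, [/\ convex_hull mu F0 (c j), (0 < rho j)%R
                                & (rho j < eps)%R]
                 & V n `<=` [set f : Y -> R | exists j,
                               dball (convex_hull mu F0) d (c j) (rho j) f]]]]) :
  forall eps : R, (0 < eps)%R ->
    {ae P, forall w,
       (fun n => posterior Pi F0 fstar n (fun i => X i w)
                   (~` dball (convex_hull mu F0) d fstar eps))
         @ \oo --> 0}.
Proof.
move=> eps eps0; have [Fs Kfin _ _] := hfstar; have dfstar := hF0 _ Fs.
have [Q [PP [QE QPP toP]]] := exists_sample_law hX.
apply: (toP (fun x : seq_space Y => (fun n => posterior Pi F0 fstar n x
  (~` dball (convex_hull mu F0) d fstar eps)) @ \oo --> 0)).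
have Hs : convex_hull mu F0 fstar by exact: sub_convex_hull.
have Klt : KL mu f0 fstar < +oo by rewrite ltey_eq Kfin.
have K0 := KL_ge0 hf0 dfstar Klt.
have [mF0 _] := hS.
set U := dball _ _ _ _.
have mU : measurable (~` U `&` F0 : set (g_sigma_algebraType S)).
  rewrite (_ : _ `&` _ = F0 `\` (U `&` F0)); last first.
    apply/seteqP; split=> f; first by case=> Uf Ff; split => // -[].
    by case=> Ff Uf; split => // Uf'; exact: Uf.
  by apply: measurableD => //; exact: hball_meas.
have e30 : (0 < eps / 3)%R by rewrite divr_gt0.
have [delta delta0 hdelta] := h2 _ e30.
have [V [W [VW [Delta KD PW] cov]]] := h3.
have [a [r [a0 r0 {}cov]]] := cov _ e30.
set K := fine (KL mu f0 fstar).
have KE : KL mu f0 fstar = K%:E by rewrite fineK.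
have Kge : (0 <= K)%R by rewrite -lee_fin -KE.
have KDe : (2 * K < Delta)%R by rewrite -lte_fin EFinM -KE.
(* [Delta = K + 3 * kap], with [kap > 0] because [Delta > 2 * K] and [K >= 0]. The choices
   [theta = K + kap] and [t = K + 2 * kap] leave strict room on both sides and the rate
   [t - theta = kap] on [W n]. *)
pose kap := ((Delta - K) / 3)%R.
(* This makes [3 * s < delta], as the strict bound asked by [cover_lik_small] requires. *)
pose s := (delta / 4)%R.
have s0 : (0 < s)%R by rewrite divr_gt0.
have kap0 : (0 < kap)%R by rewrite divr_gt0// subr_gt0; lra.
have /choice[JB hJB] : forall n, exists JB : nat * (nat -> set (Y -> R)),
  [/\ forall k, convex_densities mu (JB.2 k),
      forall k, measurable (JB.2 k `&` F0 : set (g_sigma_algebraType S)),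
      forall k f, JB.2 k f -> convex_hull mu F0 f /\
        ~ dball (convex_hull mu F0) d fstar (eps / 3) f
    & (1 <= n)%N -> (JB.1%:R <= a * n%:R `^ r)%R /\
      (V n `&` ~` U) `&` F0 `<=` \big[setU/set0]_(k < JB.1) (JB.2 k `&` F0)].
  move=> n; have [n1|n0] := leqP 1 n; last first.
    (* The covers exist from [n = 1] on; at [n = 0] an empty family fills the sequence. *)
    exists (0%N, fun=> set0); split => //= k; last by rewrite set0I.
    exact: convex_densities0.
  have [J [c [rho [Jle cP VB]]]] := cov n n1.
  have [B [? ? ? ?]] := cover_outside_ball hd hball_convex hball_meas Hs cP VB.
  by exists (J, B); split.
have hV := @cover_lik_small _ Y R S mu f0 fstar Q PP hf0 dfstar QE QPP F0 Pi
  hF0 hS s a r (fun n => (JB n).2) (fun n => (JB n).1) s0.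
have {}hV := hV (fun n => let: And4 h _ _ _ := hJB n in h)
                (fun n => let: And4 _ h _ _ := hJB n in h).
have {}hV := hV _ (fun n n1 => let: And4 _ _ _ h := hJB n in proj1 (h n1)).
have {}hV := hV _.
have hW := prior_tail_lik_small (W := W) (t := K + 2 * kap) (theta := K + kap)
  hf0 dfstar QE QPP hF0 hS Klt _ PW.
(* Twice this rate is at most [s / 2] and [kap], the rates of the two parts of the numerator, so the
   quotient still decays. *)
have e0 : (0 < Num.min (s / 4) (kap / 2))%R by rewrite lt_min; apply/andP; split; rewrite divr_gt0.
have hD := evidence_lower hf0 QE QPP dfstar Klt hF0 hS (h1 _ e0).
have {}hV : {ae PP, forall x : seq_space Y, \forall n \near \oo,
    \int[Pi]_(f in \big[setU/set0]_(k < (JB n).1)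
        ((JB n).2 k `&` F0 : set (g_sigma_algebraType S)))
      (lik_ratio fstar n x f)%:E <= (expR (- (n%:R * (s / 2))))%:E}.
  apply: hV => n k f; have [_ _ h _] := hJB n; move=> /h[Hf nf].
  apply: (@le_lt_trans _ _ (expR (- delta))%:E); last first.
    by rewrite lte_fin ltr_expR /s; lra.
  (* Contrapositive of [h2] at [eps / 3]: the sets of the cover avoid that ball, so the infimum is
     at most [exp (- delta)] on them. *)
  by rewrite leNgt; apply/negP => lt; apply: nf; apply: hdelta; split.
have {}hW : {ae PP, forall x : seq_space Y, \forall n \near \oo,
    \int[Pi]_(f in W n `&` F0) (lik_ratio fstar n x f)%:E <=
    (expR (- (n%:R * kap)))%:E}.
  have -> : (kap = (K + 2 * kap) - (K + kap))%R by ring.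
  apply: hW.
  - by move=> n /VW[].
  - by rewrite KE lte_fin; lra.
  - by rewrite /kap; lra.
move: hV hW hD; apply: filterS3 => x xV xW [C C0 xD].
(* [M = 2] counts the two parts of the numerator, the cover of [V n] and [W n]. *)
apply: (ratio_geometric_cvg0 (M := 2) C0 e0) xD.
- move=> n; apply: integral_ge0 => f [_ Ff]; rewrite lee_fin.
  by apply: (lik_ratio_ge0 n x dfstar); exact: hF0.
- move=> n; apply: integral_ge0 => f Ff; rewrite lee_fin.
  by apply: (lik_ratio_ge0 n x dfstar); exact: hF0.
have n1 : \forall n \near \oo, (1 <= n)%N by exists 1%N.
move: xV xW n1; apply: filterS3 => n nV nW n1.
have [_ mB _ /(_ n1)[_ UB]] := hJB n.
have [_ _ _ mW FVW] := VW n n1.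
pose G : set (g_sigma_algebraType S) :=
  \big[setU/set0]_(k < (JB n).1) ((JB n).2 k `&` F0).
have mG : measurable G by apply: bigsetU_measurable => k _; exact: mB.
have GF : G `<=` F0.
  by rewrite /G -(bigcup_mkord _ (fun k => (JB n).2 k `&` F0)) => f [k _ []].
have WF : W n `&` F0 `<=` F0 by move=> f [].
apply: (le_trans (integral_lik_setU_le dfstar Pi hF0 hS n x mU mG mW GF WF _)).
  move=> f [Uf Ff]; have [Vf|Wf] := FVW _ Ff; last by right.
  by left; apply: UB.
apply: (le_trans (leeD nV nW)); rewrite -EFinD lee_fin.
set m := Num.min _ _.
have ms : (m <= s / 4)%R by rewrite ge_min lexx.
have mk : (m <= kap / 2)%R by rewrite ge_min lexx orbT.
have hs : (expR (- (n%:R * (s / 2))) <= expR (- (n%:R * (2 * m))))%R.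
  by rewrite ler_expR lerN2 ler_wpM2l//; lra.
have hk : (expR (- (n%:R * kap)) <= expR (- (n%:R * (2 * m))))%R.
  by rewrite ler_expR lerN2 ler_wpM2l//; lra.
by lra.
Qed.
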